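(* Let $R$ be a Gorenstein local ring of prime characteristic $p>0$, let $n$ be a positive integer, and let $M$ be a finitely generated $R$-module. Then $$\min \operatorname{IPD}(M)\cap \operatorname{SR}_n(R)\subseteq \operatorname{Ass} F^n(M),$$ where $\min \operatorname{IPD}(M)$ is the set of minimal elements (under inclusion) of $\operatorname{IPD}(M)$. In particular, if ${}^{f^n}\! R$ is locally strongly rigid, then $$\min \operatorname{IPD}(M)\subseteq \operatorname{Ass} F^n(M).$$
   Context: All rings are commutative Noetherian local of prime characteristic $p>0$. The Frobenius endomorphism is $f\colon R\to R$, $f(r)=r^p$, with iterates $f^n(r)=r^{p^n}$. ${}^{f^n}\! R$ denotes $R$ viewed as an $R$-module by restriction of scalars along $f^n$. The Frobenius functor is $F^n(M)=M\otimes_R {}^{f^n}\! R$, i.e. base change along $f^n$; its $R$-module structure is by ordinary multiplication on the right-hand factor. An $R$-module $N$ (not necessarily finitely generated) is strongly rigid if for any integer $i>0$ and any finitely generated $R$-module $M$, $\operatorname{Tor}_i^R(M,N)=0$ implies $\operatorname{pd}_R M<\infty$ (projective dimension). $N$ is locally strongly rigid if $N_{\mathfrak p}$ is strongly rigid over $R_{\mathfrak p}$ for all $\mathfrak p\in\operatorname{Spec} R$. One identifies $({}^{f^n}\! R)_{\mathfrak p}$ with ${}^{f^n}\! R_{\mathfrak p}$, the ring $R_{\mathfrak p}$ viewed as a module over itself via its own $n$-th Frobenius iterate. $\operatorname{IPD}(M)=\{\mathfrak p\in\operatorname{Spec} R : \operatorname{pd}_{R_{\mathfrak p}} M_{\mathfrak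 p}=\infty\}$, and $\operatorname{SR}_n(R)=\{\mathfrak p\in\operatorname{Spec} R : {}^{f^n}\! R_{\mathfrak p}\text{ is a strongly rigid } R_{\mathfrak p}\text{-module}\}$. *)

(* Defs.v *)
From HB Require Import structures.
From mathcomp Require Import all_boot all_order all_algebra.
From mathcomp Require Import boolp ring.

Set Implicit Arguments.
Unset Strict Implicit.
Unset Printing Implicit Defensive.

Import GRing.Theory.
Local Open Scope ring_scope.
Local Open Scope quotient_scope.

(* Submodules, ideals and relations are boolean-valued, as in MathComp; with   *)
(* the classical axioms of [boolp] this is no restriction.                     *)

Section Finiteness.
Variable R : comNzRingType.

Definition fin_gen (M : lmodType R) : Prop :=
  exists (k : nat) (g : 'I_k -> M),
    forall x : M, exists c : 'I_k -> R, x = \sum_i c i *: g i.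

Definition noetherian : Prop :=
  forall I : {pred R^o}, submod_closed I ->
    exists (k : nat) (g : 'I_k -> R),
      forall x : R, x \in I <-> exists c : 'I_k -> R, x = \sum_i c i * g i.

(* An [idealr R] is a proper ideal. *)
Definition maximal_ideal (m : idealr R) : Prop :=
  forall J : idealr R, {subset m <= J} -> {subset J <= m}.

Definition local_ring : Prop :=
  exists2 m : idealr R, maximal_ideal m &
    forall m' : idealr R, maximal_ideal m' -> m' =i m.

End Finiteness.

Section Homological.
Variable R : comNzRingType.

Definition exact_at (A B C : lmodType R) (f : A -> B) (g : B -> C) : Prop :=
  forall b : B, g b = 0 <-> exists a : A, f a = b.

Definition projective (P : lmodType R) : Prop :=
  forall (A B : lmodType R) (g : {linear A -> B}) (h : {linear P -> B}),
    (forall b, exists a, g a = b) ->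
    exists h' : {linear P -> A}, forall x, g (h' x) = h x.

Definition injective_module (E : lmodType R) : Prop :=
  forall (A B : lmodType R) (g : {linear A -> B}) (h : {linear A -> E}),
    injective g -> exists h' : {linear B -> E}, forall x, h' (g x) = h x.

(* ... -> P_2 -> P_1 -> P_0 -> M -> 0 *)
Record proj_resolution (M : lmodType R) := ProjResolution {
  pres_obj :> nat -> lmodType R;
  pres_d : forall i, {linear pres_obj i.+1 -> pres_obj i};
  pres_aug : {linear pres_obj 0%N -> M};
  pres_proj : forall i, projective (pres_obj i);
  pres_aug_surj : forall x, exists y, pres_aug y = x;
  pres_exact0 : exact_at (pres_d 0) pres_aug;
  pres_exact : forall i, exact_at (pres_d i.+1) (pres_d i) }.

(* 0 -> M -> E_0 -> E_1 -> E_2 -> ... *)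
Record inj_resolution (M : lmodType R) := InjResolution {
  ires_obj :> nat -> lmodType R;
  ires_d : forall i, {linear ires_obj i -> ires_obj i.+1};
  ires_aug : {linear M -> ires_obj 0%N};
  ires_inj : forall i, injective_module (ires_obj i);
  ires_aug_inj : injective ires_aug;
  ires_exact0 : exact_at ires_aug (ires_d 0);
  ires_exact : forall i, exact_at (ires_d i) (ires_d i.+1) }.

Definition finite_pd (M : lmodType R) : Prop :=
  exists (P : proj_resolution M) (k : nat),
    forall i, (k < i)%N -> forall x : P i, x = 0.

Definition finite_id (M : lmodType R) : Prop :=
  exists (E : inj_resolution M) (k : nat),
    forall i, (k < i)%N -> forall x : E i, x = 0.

End Homological.

Definition gorenstein_local (R : comNzRingType) : Prop :=
  [/\ noetherian R, local_ring R & finite_id (R^o : lmodType R)].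

(* The tensor product is the type of finite formal sums of pairs, two sums     *)
(* being identified when every bilinear map takes the same value on both: the  *)
(* quotient of the free module on M x N by the bilinearity relations.          *)
(* [tens_mk] is the canonical bilinear map; [tens_liftE] and [tens_ext] are    *)
(* existence and uniqueness in the universal property.                         *)
Section Tensor.
Variables (R : comNzRingType) (M N : lmodType R).
Implicit Types s t : seq (M * N).

Definition bil_eval (L : lmodType R) (b : M -> N -> L) s : L :=
  \sum_(x <- s) b x.1 x.2.

Definition tens_rel s t : bool :=
  `[< forall (L : lmodType R) (b : {bilinear M -> N -> L}),
        bil_eval b s = bil_eval b t >].

Lemma tens_relP s t :
  reflect (forall (L : lmodType R) (b : {bilinear M -> N -> L}),
             bil_eval b s = bil_eval b t) (tens_rel s t).
Proof. exact: asboolP. Qed.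

Lemma tens_rel_equiv : equiv_class_of tens_rel.
Proof.
split=> [s|s t|s1 s2 s3].
- exact/tens_relP.
- by apply/tens_relP/tens_relP => H L b; rewrite H.
- by move=> /tens_relP H1 /tens_relP H2; apply/tens_relP => L b; rewrite H1.
Qed.

Canonical tens_equiv := EquivRelPack tens_rel_equiv.
Canonical tens_encModRel := defaultEncModRel tens_rel.

Definition tens : Type := {eq_quot tens_rel}.
HB.instance Definition _ : EqQuotient _ tens_rel tens := EqQuotient.on tens.
HB.instance Definition _ := Choice.on tens.

Lemma tens_eqP s t :
  reflect (\pi_tens s = \pi_tens t) (tens_rel s t).
Proof. by apply: (iffP idP) => [H|/eqmodP //]; apply/eqmodP. Qed.

Lemma bil_eval_repr (L : lmodType R) (b : {bilinear M -> N -> L}) s :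
  bil_eval b (repr (\pi_tens s)) = bil_eval b s.
Proof.
have /tens_eqP/tens_relP H : \pi_tens (repr (\pi_tens s)) = \pi_tens s.
  by rewrite reprK.
exact: H.
Qed.

Definition tens_zero : tens := \pi_tens [::].
Definition tens_add (x y : tens) : tens := \pi_tens (repr x ++ repr y).
Definition tens_scale (a : R) (x : tens) : tens :=
  \pi_tens [seq (a *: u.1, u.2) | u <- repr x].
Definition tens_opp : tens -> tens := tens_scale (-1).

Lemma bil_eval_cat (L : lmodType R) (b : M -> N -> L) s t :
  bil_eval b (s ++ t) = bil_eval b s + bil_eval b t.
Proof. exact: big_cat. Qed.

Lemma bil_eval_scale (L : lmodType R) (b : {bilinear M -> N -> L}) a s :
  bil_eval b [seq (a *: u.1, u.2) | u <- s] = a *: bil_eval b s.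
Proof.
rewrite /bil_eval big_map scaler_sumr; apply: eq_bigr => x _ /=.
by rewrite linearZl_LR.
Qed.

Definition tens_ev (L : lmodType R) (b : M -> N -> L) (x : tens) : L :=
  bil_eval b (repr x).

Lemma tens_inj (x y : tens) :
  (forall (L : lmodType R) (b : {bilinear M -> N -> L}),
     tens_ev b x = tens_ev b y) -> x = y.
Proof.
by move=> H; rewrite -[x]reprK -[y]reprK; apply/tens_eqP/tens_relP.
Qed.

Lemma tens_ev0 (L : lmodType R) (b : {bilinear M -> N -> L}) :
  tens_ev b tens_zero = 0.
Proof. by rewrite /tens_ev bil_eval_repr /bil_eval big_nil. Qed.

Lemma tens_evD (L : lmodType R) (b : {bilinear M -> N -> L}) x y :
  tens_ev b (tens_add x y) = tens_ev b x + tens_ev b y.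
Proof. by rewrite /tens_ev bil_eval_repr bil_eval_cat. Qed.

Lemma tens_evZ (L : lmodType R) (b : {bilinear M -> N -> L}) a x :
  tens_ev b (tens_scale a x) = a *: tens_ev b x.
Proof. by rewrite /tens_ev bil_eval_repr bil_eval_scale. Qed.

Lemma tens_addA : associative tens_add.
Proof. by move=> x y z; apply: tens_inj => L b; rewrite !tens_evD addrA. Qed.
Lemma tens_addC : commutative tens_add.
Proof. by move=> x y; apply: tens_inj => L b; rewrite !tens_evD addrC. Qed.
Lemma tens_add0 : left_id tens_zero tens_add.
Proof. by move=> x; apply: tens_inj => L b; rewrite tens_evD tens_ev0 add0r. Qed.
Lemma tens_addN : left_inverse tens_zero tens_opp tens_add.
Proof.
move=> x; apply: tens_inj => L b.
by rewrite tens_evD tens_evZ tens_ev0 scaleN1r addNr.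
Qed.
HB.instance Definition _ :=
  GRing.isZmodule.Build tens tens_addA tens_addC tens_add0 tens_addN.

Lemma tens_scaleA a b x :
  tens_scale a (tens_scale b x) = tens_scale (a * b) x.
Proof. by apply: tens_inj => L f; rewrite !tens_evZ scalerA. Qed.
Lemma tens_scale1 : left_id 1 tens_scale.
Proof. by move=> x; apply: tens_inj => L f; rewrite tens_evZ scale1r. Qed.
Lemma tens_scaleDr : right_distributive tens_scale +%R.
Proof.
move=> a x y; apply: tens_inj => L f.
by rewrite tens_evZ !tens_evD !tens_evZ scalerDr.
Qed.
Lemma tens_scaleDl x : {morph tens_scale^~ x : a b / a + b}.
Proof.
move=> a b; apply: tens_inj => L f.
by rewrite tens_evD !tens_evZ scalerDl.
Qed.
HB.instance Definition _ := GRing.Zmodule_isLmodule.Build R tens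
  tens_scaleA tens_scale1 tens_scaleDr tens_scaleDl.

Definition tens_mk (m : M) (n : N) : tens := \pi_tens [:: (m, n)].

Lemma tens_ev_mk (L : lmodType R) (b : {bilinear M -> N -> L}) m n :
  tens_ev b (tens_mk m n) = b m n.
Proof. by rewrite /tens_ev bil_eval_repr /bil_eval big_seq1. Qed.

Lemma tens_mk_bilinear : bilinear_for *:%R *:%R tens_mk.
Proof.
split=> [n a m m'|m a n n']; apply: tens_inj => L b.
  rewrite [RHS]tens_evD tens_evZ !tens_ev_mk.
  by rewrite linearPl.
rewrite [RHS]tens_evD tens_evZ !tens_ev_mk.
by rewrite linearPr.
Qed.

HB.instance Definition _ :=
  @bilinear_isBilinear.Build R M N tens *:%R *:%R tens_mk tens_mk_bilinear.

Lemma tens_mkDr m n n' : tens_mk m (n + n') = tens_mk m n + tens_mk m n'.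
Proof. exact: linearDr. Qed.

Lemma tens_ev_linear (L : lmodType R) (b : {bilinear M -> N -> L}) :
  linear (tens_ev b).
Proof. by move=> a x y; rewrite tens_evD tens_evZ. Qed.

Definition tens_lift (L : lmodType R) (b : {bilinear M -> N -> L}) : tens -> L :=
  tens_ev b.
HB.instance Definition _ (L : lmodType R) (b : {bilinear M -> N -> L}) :=
  GRing.isLinear.Build R tens L _ (tens_lift b) (tens_ev_linear b).

Lemma tens_liftE (L : lmodType R) (b : {bilinear M -> N -> L}) m n :
  tens_lift b (tens_mk m n) = b m n.
Proof. exact: tens_ev_mk. Qed.

Lemma tens_sum (x : tens) : x = \sum_(u <- repr x) tens_mk u.1 u.2.
Proof.
apply: tens_inj => L b; rewrite -![tens_ev b _]/(tens_lift b _) linear_sum /=.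
by rewrite /tens_lift {1}/tens_ev; apply: eq_bigr => u _; rewrite tens_ev_mk.
Qed.

Lemma tens_ext (L : zmodType) (f g : tens -> L) :
  zmod_morphism f -> zmod_morphism g ->
  (forall m n, f (tens_mk m n) = g (tens_mk m n)) -> f =1 g.
Proof.
move=> fB gB H x.
pose f' : {additive tens -> L} :=
  HB.pack f (GRing.isZmodMorphism.Build tens L f fB).
pose g' : {additive tens -> L} :=
  HB.pack g (GRing.isZmodMorphism.Build tens L g gB).
rewrite [x]tens_sum.
transitivity (\sum_(u <- repr x) f (tens_mk u.1 u.2)).
  exact: (raddf_sum f').
transitivity (\sum_(u <- repr x) g (tens_mk u.1 u.2)).
  by apply: eq_bigr => u _; exact: H.
by symmetry; exact: (raddf_sum g').
Qed.

End Tensor.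

Section TensorMap.
Variables (R : comNzRingType) (M M' N N' : lmodType R).
Variables (f : {linear M -> M'}) (g : {linear N -> N'}).

Definition tens_map_mk (m : M) (n : N) : tens M' N' := tens_mk (f m) (g n).

Lemma tens_map_mk_bilinear : bilinear_for *:%R *:%R tens_map_mk.
Proof.
split=> [n a m m'|m a n n'].
  by rewrite /tens_map_mk linearP linearPl.
by rewrite /tens_map_mk linearP linearPr.
Qed.
HB.instance Definition _ :=
  @bilinear_isBilinear.Build R M N (tens M' N') *:%R *:%R tens_map_mk
    tens_map_mk_bilinear.

Definition tens_map : {linear tens M N -> tens M' N'} :=
  tens_lift tens_map_mk.

Lemma tens_mapE m n : tens_map (tens_mk m n) = tens_mk (f m) (g n).
Proof. exact: tens_liftE. Qed.

End TensorMap.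

Section Tor.
Variable R : comNzRingType.

(* Vanishing of the i-th homology of the complex P (x) N. *)
Definition tens_homology_zero (M : lmodType R) (P : proj_resolution M)
    (N : lmodType R) (i : nat) : Prop :=
  let d j := tens_map (pres_d P j) (idfun : {linear N -> N}) in
  match i with
  | 0 => forall y : tens (P 0%N) N, exists x, d 0%N x = y
  | j.+1 => exact_at (d j.+1) (d j)
  end.

(* Tor_i(M, N) = 0; the homology does not depend on the resolution chosen. *)
Definition Tor_zero (i : nat) (M N : lmodType R) : Prop :=
  exists P : proj_resolution M, tens_homology_zero P N i.

Definition strongly_rigid (N : lmodType R) : Prop :=
  forall (i : nat) (M : lmodType R), (0 < i)%N -> fin_gen M ->
    Tor_zero i M N -> finite_pd M.

End Tor.

(* Localization at a prime ideal: fractions m / s with s outside q. *)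
Section Localization.
Variables (R : comNzRingType) (q : prime_idealr R).

Definition denom : Type := {s : R | s \notin q}.
HB.instance Definition _ := Choice.on denom.

Definition dval (s : denom) : R := sval s.

Lemma dvalP s : dval s \notin q. Proof. exact: valP s. Qed.

Lemma denom1_subproof : 1 \notin q. Proof. by rewrite idealr1. Qed.
Definition denom1 : denom := exist (fun u => is_true (u \notin q)) 1 denom1_subproof.

Lemma denomM_subproof (s t : denom) : dval s * dval t \notin q.
Proof. by rewrite prime_idealrM negb_or !dvalP. Qed.
Definition denomM (s t : denom) : denom :=
  exist (fun u => is_true (u \notin q)) _ (denomM_subproof s t).

Lemma dval1 : dval denom1 = 1. Proof. by []. Qed.
Lemma dvalM s t : dval (denomM s t) = dval s * dval t. Proof. by []. Qed.
Definition dvalE := (dval1, dvalM).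

Section Module.
Variable M : lmodType R.

Definition loc_rel (x y : M * denom) : bool :=
  `[< exists u : denom, (dval u * dval y.2) *: x.1 = (dval u * dval x.2) *: y.1 >].

Lemma loc_relP x y :
  reflect (exists u : denom,
             (dval u * dval y.2) *: x.1 = (dval u * dval x.2) *: y.1)
          (loc_rel x y).
Proof. exact: asboolP. Qed.

Lemma loc_rel_equiv : equiv_class_of loc_rel.
Proof.
split=> [x|x y|y x z].
- by apply/loc_relP; exists denom1.
- by apply/loc_relP/loc_relP => -[u H]; exists u; rewrite H.
- move=> /loc_relP[u Hu] /loc_relP[v Hv]; apply/loc_relP.
  exists (denomM (denomM u v) y.2); rewrite ?dvalE /=.
  have -> : dval u * dval v * dval y.2 * dval z.2
          = (dval v * dval z.2) * (dval u * dval y.2) by ring.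
  rewrite -scalerA Hu scalerA.
  have -> : dval v * dval z.2 * (dval u * dval x.2)
          = (dval u * dval x.2) * (dval v * dval z.2) by ring.
  by rewrite -scalerA Hv scalerA; congr (_ *: _); ring.
Qed.

Canonical loc_equiv := EquivRelPack loc_rel_equiv.
Canonical loc_encModRel := defaultEncModRel loc_rel.

Definition loc : Type := {eq_quot loc_rel}.
HB.instance Definition _ : EqQuotient _ loc_rel loc := EqQuotient.on loc.
HB.instance Definition _ := Choice.on loc.

Definition loc_mk (m : M) (s : denom) : loc := \pi_loc (m, s).

Lemma loc_mk_eq m s m' s' :
  loc_mk m s = loc_mk m' s' <->
  exists u : denom, (dval u * dval s') *: m = (dval u * dval s) *: m'.
Proof.
split=> [/eqmodP/loc_relP//|H]; apply/eqmodP; exact/loc_relP.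
Qed.

Lemma loc_mk_eq1 m s m' s' :
  dval s' *: m = dval s *: m' -> loc_mk m s = loc_mk m' s'.
Proof. by move=> H; apply/loc_mk_eq; exists denom1; rewrite ?dvalE !mul1r. Qed.

Variant loc_spec : loc -> Type := LocSpec m s : loc_spec (loc_mk m s).
Lemma locP x : loc_spec x.
Proof.
have -> : x = loc_mk (repr x).1 (repr x).2.
  by rewrite /loc_mk -surjective_pairing reprK.
by constructor.
Qed.

Definition loc_zero : loc := loc_mk 0 denom1.
Definition loc_add (x y : loc) : loc :=
  let: (m, s) := repr x in let: (m', s') := repr y in
  loc_mk (dval s' *: m + dval s *: m') (denomM s s').
Definition loc_opp (x : loc) : loc := loc_mk (- (repr x).1) (repr x).2.

Lemma loc_reprE m s : exists u : denom,
  (dval u * dval s) *: (repr (loc_mk m s)).1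
  = (dval u * dval (repr (loc_mk m s)).2) *: m.
Proof. by apply/loc_mk_eq; rewrite /loc_mk -surjective_pairing reprK. Qed.

Lemma loc_addE m s m' s' :
  loc_add (loc_mk m s) (loc_mk m' s')
  = loc_mk (dval s' *: m + dval s *: m') (denomM s s').
Proof.
rewrite /loc_add.
have [u] := loc_reprE m s; have [v] := loc_reprE m' s'.
case: (repr (loc_mk m s)) (repr (loc_mk m' s')) => [n t] [n' t'] /= Hv Hu.
apply/loc_mk_eq; exists (denomM u v); rewrite ?dvalE /=.
rewrite !scalerDr !scalerA; congr (_ + _).
- have -> : dval u * dval v * (dval s * dval s') * dval t'
          = (dval v * dval s' * dval t') * (dval u * dval s) by ring.
  by rewrite -scalerA Hu scalerA; congr (_ *: _); ring.
- have -> : dval u * dval v * (dval s * dval s') * dval t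
          = (dval u * dval s * dval t) * (dval v * dval s') by ring.
  by rewrite -scalerA Hv scalerA; congr (_ *: _); ring.
Qed.

Lemma loc_oppE m s : loc_opp (loc_mk m s) = loc_mk (- m) s.
Proof.
rewrite /loc_opp; have [u] := loc_reprE m s.
case: (repr (loc_mk m s)) => [n t] /= Hu.
by apply/loc_mk_eq; exists u; rewrite !scalerN Hu.
Qed.

Lemma loc_addA : associative loc_add.
Proof.
move=> x y z; case: x / (locP x) => m s; case: y / (locP y) => m' s'.
case: z / (locP z) => m'' s''; rewrite !loc_addE; apply: loc_mk_eq1; rewrite ?dvalE /=.
rewrite !scalerDr !scalerA -addrA.
by congr (_ + (_ + _)); congr (_ *: _); ring.
Qed.

Lemma loc_addC : commutative loc_add.
Proof.
move=> x y; case: x / (locP x) => m s; case: y / (locP y) => m' s'.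
rewrite !loc_addE; apply: loc_mk_eq1; rewrite ?dvalE /=.
by rewrite addrC; congr (_ *: _); ring.
Qed.

Lemma loc_add0 : left_id loc_zero loc_add.
Proof.
move=> x; case: x / (locP x) => m s.
rewrite loc_addE; apply: loc_mk_eq1; rewrite ?dvalE /=.
by rewrite scaler0 add0r scale1r mul1r.
Qed.

Lemma loc_addN : left_inverse loc_zero loc_opp loc_add.
Proof.
move=> x; case: x / (locP x) => m s.
rewrite loc_oppE loc_addE; apply: loc_mk_eq1; rewrite ?dvalE /=.
by rewrite scalerN addNr !scaler0.
Qed.

HB.instance Definition _ :=
  GRing.isZmodule.Build loc loc_addA loc_addC loc_add0 loc_addN.

Lemma loc_mkD m s m' s' :
  loc_mk m s + loc_mk m' s' = loc_mk (dval s' *: m + dval s *: m') (denomM s s').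
Proof. exact: loc_addE. Qed.

End Module.

Definition loc_ring : Type := loc R^o.
HB.instance Definition _ := GRing.Zmodule.on loc_ring.

Definition loc_frac (a : R) (s : denom) : loc_ring := @loc_mk R^o a s.

Variant loc_ring_spec : loc_ring -> Type :=
  LocRingSpec a s : loc_ring_spec (loc_frac a s).
Lemma loc_ringP x : loc_ring_spec x.
Proof. by case: x / (@locP R^o x) => m s; exact: (LocRingSpec m s). Qed.

Lemma loc_frac_eq a s b t :
  loc_frac a s = loc_frac b t <->
  exists u : denom, dval u * dval t * a = dval u * dval s * b.
Proof. exact: (@loc_mk_eq R^o). Qed.

Lemma loc_frac_eq1 a s b t : dval t * a = dval s * b -> loc_frac a s = loc_frac b t.
Proof. exact: (@loc_mk_eq1 R^o). Qed.

Lemma loc_fracD a s b t :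
  loc_frac a s + loc_frac b t = loc_frac (dval t * a + dval s * b) (denomM s t).
Proof. exact: (@loc_mkD R^o). Qed.

Section Scale.
Variable M : lmodType R.

Definition loc_scale (x : loc_ring) (y : loc M) : loc M :=
  let: (a, s) := repr x in let: (m, t) := repr y in
  loc_mk ((a : R) *: m) (denomM s t).

Lemma loc_scaleE a s m t :
  loc_scale (loc_frac a s) (loc_mk m t) = loc_mk (a *: m) (denomM s t).
Proof.
rewrite /loc_scale.
have [u] := @loc_reprE R^o a s; have [v] := loc_reprE m t.
rewrite /loc_frac.
case: (repr (@loc_mk R^o a s)) (repr (loc_mk m t)) => [b s'] [n t'] /= Hv Hu.
apply/loc_mk_eq; exists (denomM u v); rewrite ?dvalE /= !scalerA.
have -> : dval u * dval v * (dval s * dval t) * b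
        = (dval u * dval s * b) * (dval v * dval t) by ring.
rewrite -scalerA Hv scalerA.
have -> : dval u * dval s * b = dval u * dval s' * a by exact: Hu.
by congr (_ *: _); ring.
Qed.
End Scale.

Definition loc_one : loc_ring := loc_frac 1 denom1.
Definition loc_mul (x y : loc_ring) : loc_ring := @loc_scale R^o x y.

Lemma loc_mulE a s b t :
  loc_mul (loc_frac a s) (loc_frac b t) = loc_frac (a * b) (denomM s t).
Proof. exact: (@loc_scaleE R^o). Qed.

Lemma loc_mulA : associative loc_mul.
Proof.
move=> x y z; case: x / (loc_ringP x) => a s; case: y / (loc_ringP y) => b t.
case: z / (loc_ringP z) => c u; rewrite !loc_mulE.
by apply: loc_frac_eq1; rewrite ?dvalE /=; ring.
Qed.

Lemma loc_mulC : commutative loc_mul.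
Proof.
move=> x y; case: x / (loc_ringP x) => a s; case: y / (loc_ringP y) => b t.
by rewrite !loc_mulE; apply: loc_frac_eq1; rewrite ?dvalE /=; ring.
Qed.

Lemma loc_mul1 : left_id loc_one loc_mul.
Proof.
move=> x; case: x / (loc_ringP x) => a s.
by rewrite !loc_mulE; apply: loc_frac_eq1; rewrite ?dvalE /=; ring.
Qed.

Lemma loc_mulDl : left_distributive loc_mul +%R.
Proof.
move=> x y z; case: x / (loc_ringP x) => a s; case: y / (loc_ringP y) => b t.
case: z / (loc_ringP z) => c u; rewrite !(loc_mulE, loc_fracD).
by apply: loc_frac_eq1; rewrite ?dvalE /=; ring.
Qed.

Lemma loc_one_neq0 : loc_one != 0.
Proof.
apply/eqP => /loc_frac_eq[u]; rewrite ?dvalE !mulr1 mulr0 => u0.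
by have := dvalP u; rewrite u0 rpred0.
Qed.

HB.instance Definition _ := GRing.Zmodule_isComNzRing.Build loc_ring
  loc_mulA loc_mulC loc_mul1 loc_mulDl loc_one_neq0.

Section Lmod.
Variable M : lmodType R.

Lemma loc_scaleA (a b : loc_ring) (x : loc M) :
  loc_scale a (loc_scale b x) = loc_scale (a * b) x.
Proof.
case: a / (loc_ringP a) => a s; case: b / (loc_ringP b) => b t.
case: x / (locP x) => m u; rewrite [_ * _]loc_mulE !loc_scaleE.
by apply: loc_mk_eq1; rewrite ?dvalE /= !scalerA; congr (_ *: _); ring.
Qed.

Lemma loc_scale1 : left_id 1 (@loc_scale M).
Proof.
move=> x; case: x / (locP x) => m s; rewrite loc_scaleE.
by apply: loc_mk_eq1; rewrite ?dvalE /= scale1r mul1r.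
Qed.

Lemma loc_scaleDr : right_distributive (@loc_scale M) +%R.
Proof.
move=> a x y; case: a / (loc_ringP a) => a s; case: x / (locP x) => m t.
case: y / (locP y) => n u; rewrite !(loc_mkD, loc_scaleE).
apply: loc_mk_eq1; rewrite ?dvalE /= !scalerDr !scalerA.
by congr (_ + _); congr (_ *: _); ring.
Qed.

Lemma loc_scaleDl (x : loc M) : {morph (@loc_scale M)^~ x : a b / a + b}.
Proof.
move=> a b; case: x / (locP x) => m u.
case: a / (loc_ringP a) => a s; case: b / (loc_ringP b) => b t.
rewrite !(loc_fracD, loc_scaleE, loc_mkD).
apply: loc_mk_eq1; rewrite ?dvalE /= !scalerA -scalerDl scalerA.
by congr (_ *: _); ring.
Qed.

HB.instance Definition _ := GRing.Zmodule_isLmodule.Build loc_ring (loc M)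
  loc_scaleA loc_scale1 loc_scaleDr loc_scaleDl.
End Lmod.

Lemma loc_natr k : (k%:R : loc_ring) = loc_frac k%:R denom1.
Proof.
elim: k => [//|k IH]; rewrite -!natr1 IH.
rewrite [LHS](loc_fracD _ _ 1 denom1).
by apply: loc_frac_eq1; rewrite ?dvalE /=; ring.
Qed.

Lemma loc_pchar p : p \in [pchar R] -> p \in [pchar loc_ring].
Proof.
rewrite !inE => /andP[-> /eqP p0] /=.
by rewrite loc_natr p0.
Qed.

End Localization.

(* N with R acting through phi; phi only serves to select the module structure. *)
Definition restr (R S : comNzRingType) (phi : {rmorphism R -> S})
  (N : lmodType S) : Type := N.

Section RestrictionOfScalars.
Variables (R S : comNzRingType) (phi : {rmorphism R -> S}) (N : lmodType S).

HB.instance Definition _ := GRing.Zmodule.on (restr phi N).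

Definition restr_scale (a : R) (x : restr phi N) : restr phi N := phi a *: (x : N).

Lemma restr_scaleA a b x :
  restr_scale a (restr_scale b x) = restr_scale (a * b) x.
Proof. by rewrite /restr_scale scalerA -rmorphM. Qed.
Lemma restr_scale1 : left_id 1 restr_scale.
Proof. by move=> x; rewrite /restr_scale rmorph1 scale1r. Qed.
Lemma restr_scaleDr : right_distributive restr_scale +%R.
Proof. by move=> a x y; rewrite /restr_scale scalerDr. Qed.
Lemma restr_scaleDl x : {morph restr_scale^~ x : a b / a + b}.
Proof. by move=> a b; rewrite /restr_scale rmorphD scalerDl. Qed.
HB.instance Definition _ := GRing.Zmodule_isLmodule.Build R (restr phi N)
  restr_scaleA restr_scale1 restr_scaleDr restr_scaleDl.

End RestrictionOfScalars.

(* M (x)_R S as an S-module: S acts by multiplication on the right factor. *)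
Section BaseChange.
Variables (R S : comNzRingType) (phi : {rmorphism R -> S}) (M : lmodType R).

Let S' : lmodType R := restr phi S^o.

Definition base_change : Type := tens M S'.
HB.instance Definition _ := GRing.Zmodule.on base_change.

Definition bc_mul (c : S) (x : S') : S' := c * (x : S).
Lemma bc_mul_linear c : linear (bc_mul c).
Proof.
by move=> a x y; rewrite /bc_mul mulrDr; congr (_ + _); rewrite [LHS]mulrCA.
Qed.
HB.instance Definition _ c :=
  GRing.isLinear.Build R S' S' _ (bc_mul c) (bc_mul_linear c).

Definition bc_scale (c : S) : base_change -> base_change :=
  tens_map (idfun : {linear M -> M}) (bc_mul c).

Lemma bc_scaleE c m (x : S) :
  bc_scale c (tens_mk m (x : S')) = tens_mk m (c * x : S').
Proof. exact: tens_mapE. Qed.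

Lemma bc_scaleB c : zmod_morphism (bc_scale c).
Proof. exact: raddfB. Qed.

Lemma bc_scaleA a b x : bc_scale a (bc_scale b x) = bc_scale (a * b) x.
Proof.
move: x; apply: tens_ext => [x y|x y|m n]; rewrite ?bc_scaleB //.
by rewrite !bc_scaleE mulrA.
Qed.
Lemma bc_scale1 : left_id 1 bc_scale.
Proof.
apply: tens_ext => [x y|x y|m n]; rewrite ?bc_scaleB //.
by rewrite bc_scaleE mul1r.
Qed.
Lemma bc_scaleDr : right_distributive bc_scale +%R.
Proof. by move=> a x y; rewrite /bc_scale raddfD. Qed.
Lemma bc_scaleDl x : {morph bc_scale^~ x : a b / a + b}.
Proof.
move=> a b; move: x; apply: tens_ext => [x y|x y|m n].
- by rewrite bc_scaleB.
- by rewrite !bc_scaleB opprD addrACA.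
- rewrite !bc_scaleE mulrDl.
  exact: (@tens_mkDr R M S').
Qed.
HB.instance Definition _ := GRing.Zmodule_isLmodule.Build S base_change
  bc_scaleA bc_scale1 bc_scaleDr bc_scaleDl.

End BaseChange.

Section Frobenius.
Variables (R : comNzRingType) (p : nat) (hp : p \in [pchar R]) (n : nat).

Definition frob of p \in [pchar R] : R -> R := fun r => r ^+ (p ^ n).

Lemma frob_zmod_morphism : zmod_morphism (frob hp).
Proof.
have pn : [pchar R].-nat (p ^ n)%N.
  by rewrite pnatX (pi_pnat (pnat_id (pcharf_prime hp)) hp).
move=> x y; rewrite /frob exprDn_pchar // exprNn_pchar //.
Qed.
Lemma frob_monoid_morphism : monoid_morphism (frob hp).
Proof. by split=> [|x y]; rewrite /frob ?expr1n ?exprMn. Qed.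
HB.instance Definition _ := GRing.isZmodMorphism.Build R R (frob hp)
  frob_zmod_morphism.
HB.instance Definition _ := GRing.isMonoidMorphism.Build R R (frob hp)
  frob_monoid_morphism.

Definition frob_module : lmodType R := restr (frob hp) R^o.

Definition frob_functor (M : lmodType R) : lmodType R := base_change (frob hp) M.

End Frobenius.

Section Spectrum.
Variable R : comNzRingType.
Implicit Types M N : lmodType R.

(* Subsets of Spec R are predicates on [prime_idealr R]. *)
Definition Ass M (q : prime_idealr R) : Prop :=
  exists x : M, forall a : R, a \in q <-> a *: x = 0.

Definition IPD M (q : prime_idealr R) : Prop :=
  ~ finite_pd (loc q M : lmodType (loc_ring q)).

Definition minimal_in (A : prime_idealr R -> Prop) (q : prime_idealr R) : Prop :=
  A q /\
  forall q' : prime_idealr R, A q' -> {subset q' <= q} -> {subset q <= q'}.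

Definition SR (p : nat) (hp : p \in [pchar R]) (n : nat) (q : prime_idealr R) :
    Prop :=
  strongly_rigid (frob_module (loc_pchar q hp) n).

Definition locally_strongly_rigid N : Prop :=
  forall q : prime_idealr R, strongly_rigid (loc q N : lmodType (loc_ring q)).

End Spectrum.

(* Main.v *)
Require Import Defs.
From HB Require Import structures.
From mathcomp Require Import all_boot all_order all_algebra.
From mathcomp Require Import boolp ring.
Set Implicit Arguments.
Unset Strict Implicit.
Unset Printing Implicit Defensive.
Import GRing.Theory.
Local Open Scope ring_scope.

(** Let [P] be a resolution of [M] by finite free modules and let [F] denote
    base change along the [n]-th Frobenius, which raises the entries of a matrix
    to the power [p ^ n].

    Since [R] has finite injective dimension over itself, all positive Ext
    groups from a high syzygy of [M] to [R] vanish.  The dual of the tail of [P]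
    is therefore exact and can be resolved by finite free modules; dualizing
    back gives an exact complex [T] with exact dual, which agrees with [P] in
    high degrees, is prolonged one step beyond degree [0], and maps to [P] by a
    chain map [phi] ([completion_exists]).  The cone of [phi] is a complex that
    is exact in positive degrees and splits in high degrees: it resolves a module
    of finite projective dimension containing [M].

    By the theorem of Peskine and Szpiro ([peskine_szpiro]) the Frobenius keeps
    this cone exact, so that [H_1 (F T)] embeds into [H_0 (F P) = F M]
    ([comparison_injective]).  Now [H_1 (F T)] is a Tor_1 of the cokernel of [T].
    At a prime where [M] has finite projective dimension [T] splits, so that
    [F T] has no homology there ([cycle_split]).  At a prime of infinite
    projective dimension where the Frobenius is strongly rigid this homology
    does not vanish ([cycle_rigid]).  At a minimal prime [q] of infinite
    projective dimension, [H_1 (F T)] localized at [q] is thus nonzero and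
    supported only at the closed point, which yields a class with annihilator
    [q] ([cycle_annihilator]), and its image in [F M] has the same annihilator.

    The theorem of Peskine and Szpiro is proved by localizing at a prime where
    the homology becomes torsion.  Over a local ring, a finite free resolution
    splits above the depth ([split_step]), a property inherited by its image
    under any ring endomorphism, and the acyclicity lemma ([acyclicity]) applies.

    The second assertion follows from the first because localization commutes
    with the Frobenius module structure ([strongly_rigid_loc]). *)

(** * Exact, split and regular matrices *)

Section ExactMatrices.
Variable R : comNzRingType.

(** Matrices act on row vectors from the right, so the composite of [c] and [a]
    is [c *m a]. *)
Definition exmx k n m (c : 'M[R]_(k, n)) (a : 'M_(n, m)) : Prop :=
  forall v : 'rV_n, v *m a = 0 <-> exists w, v = w *m c.

(** A contracting homotopy at the middle term. *)
Definition splitmx k n m (c : 'M[R]_(k, n)) (a : 'M_(n, m)) : Prop :=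
  exists h x, a *m h + x *m c = 1%:M.

(** Von Neumann regularity, which says that the cokernel of [a] is projective.
    As an equation between matrices it is stable under ring morphisms and under
    transposition. *)
Definition regmx n m (a : 'M[R]_(n, m)) : Prop := exists h, a *m h *m a = a.

Lemma row_choice k n m (c : 'M[R]_(k, n)) (X : 'M_(m, n)) :
  (forall i, exists w, row i X = w *m c) -> exists Y, X = Y *m c.
Proof.
move=> /choice[f Hf]; exists (\matrix_i f i).
by apply/row_matrixP => i; rewrite row_mul rowK.
Qed.

Lemma exmx_mul0 k n m (c : 'M[R]_(k, n)) (a : 'M_(n, m)) :
  exmx c a -> c *m a = 0.
Proof.
move=> ex; apply/row_matrixP => i; rewrite row_mul row0.
by apply/ex; exists (delta_mx 0 i); rewrite rowE.
Qed.

Lemma exmx_factor k n m (c : 'M[R]_(k, n)) (a : 'M_(n, m)) r (X : 'M_(r, n)) :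
  exmx c a -> X *m a = 0 -> exists Y, X = Y *m c.
Proof.
move=> ex X0; apply: row_choice => i; apply/ex.
by rewrite -row_mul X0 row0.
Qed.

Lemma exmxP k n m (c : 'M[R]_(k, n)) (a : 'M_(n, m)) :
  c *m a = 0 -> (forall v : 'rV_n, v *m a = 0 -> exists w, v = w *m c) ->
  exmx c a.
Proof.
by move=> ca0 ex v; split=> [/ex//|[w ->]]; rewrite -mulmxA ca0 mulmx0.
Qed.

Lemma split_exmx k n m (c : 'M[R]_(k, n)) (a : 'M_(n, m)) :
  c *m a = 0 -> splitmx c a -> exmx c a.
Proof.
move=> ca0 [h [x e]]; apply: exmxP => // v va0; exists (v *m x).
by rewrite -[LHS]mulmx1 -e mulmxDr !mulmxA va0 mul0mx add0r.
Qed.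

Lemma split_regl k n m (c : 'M[R]_(k, n)) (a : 'M_(n, m)) :
  c *m a = 0 -> splitmx c a -> regmx c.
Proof.
move=> ca0 [h [x e]]; exists x.
by rewrite -mulmxA -[RHS]mulmx1 -e mulmxDr !mulmxA ca0 mul0mx add0r.
Qed.

Lemma exmx_reg_split k n m (c : 'M[R]_(k, n)) (a : 'M_(n, m)) :
  exmx c a -> regmx a -> splitmx c a.
Proof.
move=> ex [h e]; have /(exmx_factor ex)[x xE] : (1%:M - a *m h) *m a = 0.
  by rewrite mulmxBl mul1mx e subrr.
by exists h, x; rewrite -xE addrC subrK.
Qed.

(** If the cokernel of [a] is projective, so is the image of [a], which is the
    cokernel of [c]. *)
Lemma exmx_reg k n m (c : 'M[R]_(k, n)) (a : 'M_(n, m)) :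
  exmx c a -> regmx a -> regmx c.
Proof.
by move=> ex ra; apply: split_regl (exmx_mul0 ex) (exmx_reg_split ex ra).
Qed.

Lemma regmx_tr n m (a : 'M[R]_(n, m)) : regmx a -> regmx a^T.
Proof. by case=> h e; exists h^T; rewrite -!trmx_mul mulmxA e. Qed.

End ExactMatrices.

Section MapMatrices.
Variables (R S : comNzRingType) (f : {rmorphism R -> S}).

Lemma map_splitmx k n m (c : 'M[R]_(k, n)) (a : 'M_(n, m)) :
  splitmx c a -> splitmx (map_mx f c) (map_mx f a).
Proof.
case=> h [x e]; exists (map_mx f h), (map_mx f x).
by rewrite -!map_mxM -map_mxD e map_mx1.
Qed.

End MapMatrices.

(** * Complexes of finite free modules *)

Record cpx (R : comNzRingType) :=
  Cpx { rk : nat -> nat; dif : forall i, 'M[R]_(rk i.+1, rk i) }.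

Section Complexes.
Variable R : comNzRingType.
Implicit Types C : cpx R.

Definition cshift C := Cpx (fun i => dif C i.+1).

Definition ccons C n (d : 'M_(rk C 0, n)) : cpx R :=
  @Cpx R (fun i => if i is j.+1 then rk C j else n)
    (fun i => match i return
        'M_(rk C i, if i is j.+1 then rk C j else n) with
      | 0 => d | j.+1 => dif C j end).

Definition is_cpx C := forall i, dif C i.+1 *m dif C i = 0.
(** The [i]-th condition concerns the term of degree [i.+1]; in particular
    [exact_from 0] says nothing about degree [0]. *)
Definition exact_from s C :=
  forall i, (s <= i)%N -> exmx (dif C i.+1) (dif C i).
Definition split_from s C :=
  forall i, (s <= i)%N -> splitmx (dif C i.+1) (dif C i).

(** Transposition is duality on finite free modules. *)
Definition coexact C :=
  forall i, exmx (dif C i)^T (dif C i.+1)^T.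

End Complexes.

Definition cmap (R S : comNzRingType) (f : {rmorphism R -> S}) (C : cpx R) :
  cpx S := Cpx (fun i => map_mx f (dif C i)).

Lemma cmap_cpx (R S : comNzRingType) (f : {rmorphism R -> S}) (C : cpx R) :
  is_cpx C -> is_cpx (cmap f C).
Proof. by move=> HC i; rewrite /= -map_mxM HC map_mx0. Qed.

Lemma cmap_split (R S : comNzRingType) (f : {rmorphism R -> S}) (C : cpx R) s :
  split_from s C -> split_from s (cmap f C).
Proof. by move=> HC i /HC; apply: map_splitmx. Qed.

(** * Exactness modulo a regular sequence *)

Section RegularSequences.
Variable R : comNzRingType.

Record is_ideal (J : R -> Prop) : Prop := IsIdeal {
  id0 : J 0;
  idD : forall x y, J x -> J y -> J (x + y);
  idM : forall a x, J x -> J (a * x) }.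

Definition addJ (J : R -> Prop) x a := exists b c, J b /\ a = b + x * c.

Definition regJ (J : R -> Prop) x := forall a, J (x * a) -> J a.

Lemma idN J x : is_ideal J -> J x -> J (- x).
Proof. by move=> HJ Jx; rewrite -mulN1r; apply: idM. Qed.

Lemma idB J x y : is_ideal J -> J x -> J y -> J (x - y).
Proof. by move=> HJ Jx Jy; apply: idD => //; apply: idN. Qed.

Lemma id_sum J (I : Type) (r : seq I) (P : pred I) (F : I -> R) :
  is_ideal J -> (forall i, J (F i)) -> J (\sum_(i <- r | P i) F i).
Proof. by move=> HJ HF; elim/big_rec: _ => [|i x _]; [apply: id0|apply: idD]. Qed.

Lemma addJ_ideal J x : is_ideal J -> is_ideal (addJ J x).
Proof.
move=> HJ; split.
- by exists 0, 0; split; [apply: id0|rewrite mulr0 addr0].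
- move=> _ _ [b [c [Jb ->]]] [b' [c' [Jb' ->]]].
  by exists (b + b'), (c + c'); split; [apply: idD|ring].
- move=> a _ [b [c [Jb ->]]]; exists (a * b), (a * c).
  by split; [apply: idM|ring].
Qed.

Lemma sub_addJ J x a : J a -> addJ J x a.
Proof. by move=> Ja; exists a, 0; rewrite mulr0 addr0. Qed.

Lemma addJ_gen J x : is_ideal J -> addJ J x x.
Proof. by move=> HJ; exists 0, 1; rewrite mulr1 add0r; split=> //; apply: id0. Qed.

Definition inJ J n m (A : 'M[R]_(n, m)) : Prop := forall i j, J (A i j).

Section InJ.
Variables (J : R -> Prop) (HJ : is_ideal J).

Lemma inJD n m (A B : 'M_(n, m)) : inJ J A -> inJ J B -> inJ J (A + B).
Proof. by move=> HA HB i j; rewrite mxE; apply: idD. Qed.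
Lemma inJN n m (A : 'M_(n, m)) : inJ J A -> inJ J (- A).
Proof. by move=> HA i j; rewrite mxE; apply: idN. Qed.
Lemma inJZ n m a (A : 'M_(n, m)) : inJ J A -> inJ J (a *: A).
Proof. by move=> HA i j; rewrite mxE; apply: idM. Qed.
Lemma inJMr n m k (A : 'M_(n, m)) (B : 'M_(m, k)) : inJ J A -> inJ J (A *m B).
Proof.
by move=> HA i j; rewrite mxE; apply: id_sum => // l; rewrite mulrC; apply: idM.
Qed.
Lemma inJ_add x n m (A : 'M_(n, m)) :
  inJ (addJ J x) A -> exists B U, inJ J B /\ A = B + x *: U.
Proof.
move=> HA.
have /choice[f Hf] : forall u : 'I_n * 'I_m, exists bc : R * R,
    J bc.1 /\ A u.1 u.2 = bc.1 + x * bc.2.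
  by move=> [i j]; have [b [c Hbc]] := HA i j; exists (b, c).
exists (\matrix_(i, j) (f (i, j)).1), (\matrix_(i, j) (f (i, j)).2); split.
  by move=> i j; rewrite mxE; have [] := Hf (i, j).
by apply/matrixP => i j; rewrite !mxE; have [] := Hf (i, j).
Qed.

Lemma inJ_reg x n m (A : 'M_(n, m)) : regJ J x -> inJ J (x *: A) -> inJ J A.
Proof. by move=> rx HA i j; apply: rx; have := HA i j; rewrite mxE. Qed.

End InJ.

(** Working modulo an ideal [J] instead of over the quotient ring keeps all
    matrices over one ring while the ideal grows along a regular sequence. *)
Definition exmod J k n m (c : 'M[R]_(k, n)) (a : 'M_(n, m)) : Prop :=
  forall v : 'rV_n, inJ J (v *m a) -> exists w, inJ J (v - w *m c).

Lemma split_exmod J k n m (c : 'M[R]_(k, n)) (a : 'M_(n, m)) :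
  is_ideal J -> splitmx c a -> exmod J c a.
Proof.
move=> HJ [h [x e]] v Hv; exists (v *m x).
have -> : v - v *m x *m c = v *m a *m h.
  by rewrite -[v in v - _]mulmx1 -e mulmxDr !mulmxA addrK.
exact: inJMr.
Qed.

Fixpoint addJs J (xs : seq R) :=
  if xs is x :: xs' then addJs (addJ J x) xs' else J.

Fixpoint regseq J (xs : seq R) :=
  if xs is x :: xs' then regJ J x /\ regseq (addJ J x) xs' else True.

Lemma addJs_ideal J xs : is_ideal J -> is_ideal (addJs J xs).
Proof. by elim: xs J => //= x xs IH J /(addJ_ideal x); apply: IH. Qed.

Lemma addJs_rcons J xs x : addJs J (rcons xs x) = addJ (addJs J xs) x.
Proof. by elim: xs J => //= y xs IH J. Qed.

Lemma regseq_rcons J xs x :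
  regseq J (rcons xs x) <-> regseq J xs /\ regJ (addJs J xs) x.
Proof.
elim: xs J => [|y xs IH] J /=; first by split=> [[]|[]].
by rewrite IH; split=> [[? []]|[[]]].
Qed.

(** Dividing by a regular element costs one degree of exactness: this is the
    long exact homology sequence of multiplication by [x]. *)
Lemma exmod_addJ J x k n m l (e : 'M[R]_(l, k)) (c : 'M_(k, n)) (a : 'M_(n, m)) :
  is_ideal J -> regJ J x -> c *m a = 0 ->
  exmod J c a -> exmod J e c -> exmod (addJ J x) e c.
Proof.
move=> HJ rx ca0 Ha Hc v /inJ_add[B [U [JB vcE]]].
have : inJ J (U *m a).
  apply: (inJ_reg rx); have -> : x *: (U *m a) = - (B *m a).
    apply/eqP; rewrite -addr_eq0 scalemxAl -mulmxDl addrC -vcE.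
    by rewrite -mulmxA ca0 mulmx0.
  by apply: inJN => //; apply: inJMr.
move=> /Ha[w Jw]; have : inJ J ((v - x *: w) *m c).
  rewrite mulmxBl vcE -addrA -scalemxAl -scalerBr.
  by apply: inJD => //; apply: inJZ.
move=> /Hc[y Jy]; exists y => i j.
exists ((v - x *: w - y *m e) i j), (w i j); split; first exact: Jy.
by rewrite !mxE; ring.
Qed.

Lemma exmod_addJs J xs (C : cpx R) s :
  is_ideal J -> regseq J xs -> is_cpx C ->
  (forall i, (s <= i)%N -> exmod J (dif C i.+1) (dif C i)) ->
  forall i, (size xs + s <= i)%N -> exmod (addJs J xs) (dif C i.+1) (dif C i).
Proof.
move=> HJ + HC; elim: xs J HJ s => [|x xs IH] J HJ s //= [rx rxs] Hex i.
rewrite addSnnS => Hi; apply: IH Hi => //; first exact: addJ_ideal.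
case=> // {}i Hi; apply: (exmod_addJ HJ rx (HC i)); apply: Hex => //.
exact: leqW.
Qed.

(** The Peskine-Szpiro acyclicity lemma: a complex whose length does not exceed
    the depth has no nonzero homology supported at the closed point.  Dividing
    by the first element [x] of the sequence, the induction makes the next
    homology module mod [x] vanish, so [x] acts injectively on the homology;
    but it also acts nilpotently. *)
Lemma acyclicity J xs (D : cpx R) s :
  is_ideal J -> regseq J xs -> is_cpx D ->
  split_from (size xs + s) D ->
  (forall x, x \in xs -> forall i, (s <= i)%N -> forall v : 'rV_(rk D i.+1),
     inJ J (v *m dif D i) ->
     exists N w, inJ J (x ^+ N *: v - w *m dif D i.+1)) ->
  forall i, (s <= i)%N -> exmod J (dif D i.+1) (dif D i).
Proof.
move=> + + HD; elim: xs J s => [|x xs IH] J s HJ /=.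
  by move=> _ Hs _ i Hi; apply: split_exmod => //; apply: Hs.
move=> [rx rxs] Hs Htor.
have Hex : forall i, (s < i)%N -> exmod (addJ J x) (dif D i.+1) (dif D i).
  apply: IH => //; first exact: addJ_ideal; first by rewrite addnS.
  move=> y yxs [//|i] Hi v /inJ_add[B [U [JB vE]]].
  have JU : inJ J (U *m dif D i).
    apply: (inJ_reg rx); have -> : x *: (U *m dif D i) = - (B *m dif D i).
      apply/eqP; rewrite -addr_eq0 scalemxAl -mulmxDl addrC -vE.
      by rewrite -mulmxA HD mulmx0.
    by apply: inJN => //; apply: inJMr.
  have yin : y \in x :: xs by rewrite inE yxs orbT.
  have [N [w Jw]] := Htor y yin i Hi U JU.
  have : inJ J ((y ^+ N *: v - x *: w) *m dif D i.+1).
    rewrite mulmxBl -!scalemxAl vE scalerDr scalerA mulrC -scalerA -addrA.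
    by rewrite -scalerBr; apply: inJD => //; apply: inJZ.
  move=> /(Htor y yin i.+1 (ltnW Hi))[N' [w' Jw']].
  exists (N' + N)%N, w' => i1 j1; have := Jw' i1 j1.
  set a := (X in J X); move=> Ja; exists a, (y ^+ N' * w i1 j1); split=> //.
  by rewrite /a !mxE exprD; ring.
move=> i Hi v Jv; have [N [w]] := Htor x (mem_head _ _) i Hi v Jv.
(* Powers of [x] are divided out one at a time. *)
elim: N w => [|N IHN] w; first by rewrite expr0 scale1r => Jw; exists w.
rewrite exprS -scalerA; set v' := _ *: v => Jw.
have Jv' : inJ J (v' *m dif D i) by rewrite -scalemxAl; apply: inJZ.
have : inJ (addJ J x) (w *m dif D i.+1).
  move=> i1 j1; exists (- (x *: v' - w *m dif D i.+1) i1 j1), (v' i1 j1).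
  split; first by apply: idN.
  by set wd := w *m _; clearbody wd; rewrite !mxE; ring.
move=> /(Hex i.+1 Hi)[e] /inJ_add[B [U [JB wE]]].
apply: (IHN (U : 'rV__)); apply: (inJ_reg rx).
have -> : x *: (v' - U *m dif D i.+1)
    = (x *: v' - w *m dif D i.+1) + B *m dif D i.+1.
  move/eqP: wE; rewrite subr_eq => /eqP->.
  rewrite !mulmxDl -[_ *m _ *m dif D i.+1]mulmxA HD mulmx0 addr0 -scalemxAl.
  by rewrite scalerBr opprD -addrA [- _ - _ + _]addrAC addNr add0r.
by apply: inJD => //; apply: inJMr.
Qed.

End RegularSequences.

(** * Noetherian rings *)

Section Noetherian.
Variable R : comNzRingType.

Lemma is_ideal_submod (J : R -> Prop) : is_ideal J ->
  submod_closed ([pred a | `[< J a >]] : {pred R^o}).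
Proof.
move=> HJ; split=> [|a x y]; rewrite !inE; first exact/asboolP/(id0 HJ).
move=> /asboolP Jx /asboolP Jy; apply/asboolP.
by apply: (idD HJ) => //; apply: (idM HJ).
Qed.

Hypothesis noeR : noetherian R.

Lemma ideal_fg (J : R -> Prop) : is_ideal J ->
  exists k (g : 'I_k -> R), forall x, J x <-> exists c, x = \sum_i c i * g i.
Proof.
move=> /is_ideal_submod/noeR[k [g Hg]]; exists k, g => x.
by rewrite -Hg; split=> [Jx|/asboolP//]; apply/asboolP.
Qed.

(** Without a maximal member, dependent choice yields a strictly increasing
    chain; its union is finitely generated, hence reached at a finite stage. *)
Lemma noeth_max (P : (R -> Prop) -> Prop) :
  (forall J, P J -> is_ideal J) -> (exists J, P J) ->
  exists2 J, P J & forall J', P J' -> (forall a, J a -> J' a) ->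
    forall a, J' a -> J a.
Proof.
move=> Pid [J0 PJ0]; apply: contrapT => noMax.
pose S := {J : R -> Prop | P J}.
have next (J : S) : exists J' : S,
    (forall a, sval J a -> sval J' a) /\ ~ (forall a, sval J' a -> sval J a).
  apply: contrapT => noJ'; apply: noMax; exists (sval J); first exact: svalP.
  move=> J' PJ' JJ' a J'a; apply: contrapT => nJa; apply: noJ'.
  by exists (exist _ J' PJ'); split=> // /(_ a J'a).
have [f Hf] := choice next.
pose s i := sval (iter i f (exist _ J0 PJ0)).
have sS i a : s i a -> s i.+1 a by apply: (Hf _).1.
have sid i : is_ideal (s i) by apply/Pid/svalP.
have smono i j a : (i <= j)%N -> s i a -> s j a.
  by move/subnK<-; elim: (j - i)%N => //= k IH /IH/sS.
have : is_ideal (fun a => exists i, s i a).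
  split=> [|x y [i ix] [j jy]|a x [i ix]]; first by exists 0%N; apply: id0.
  - exists (maxn i j); apply: idD => //.
    + by apply: smono ix; apply: leq_maxl.
    + by apply: smono jy; apply: leq_maxr.
  - by exists i; apply: idM.
move=> /ideal_fg[k [g Hg]].
have /choice[n Hn] : forall i, exists n, s n (g i).
  move=> i; apply/Hg; exists (fun j => (j == i)%:R).
  rewrite (bigD1 i) //= eqxx mul1r big1 ?addr0 // => j /negPf->.
  by rewrite mul0r.
pose N := \max_i n i; have [_] := Hf (iter N f (exist _ J0 PJ0)); apply.
move=> a sNa; have /Hg[c ->] : exists i, s i a by exists N.+1.
apply: (id_sum _ _ (sid N)) => i; apply: (idM (sid N)).
by apply: smono (Hn i); apply: leq_bigmax.
Qed.

(** Submodules of [R^n] are finitely generated: induct on [n], splitting off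
    the ideal of first coordinates. *)
Lemma submod_fg n (K : 'rV[R]_n -> Prop) :
  K 0 -> (forall x y, K x -> K y -> K (x + y)) ->
  (forall a x, K x -> K (a *: x)) ->
  exists k (c : 'M_(k, n)), forall v, K v <-> exists w, v = w *m c.
Proof.
elim: n K => [|n IH] K K0 KD KZ.
  exists 0%N, 0 => v; split=> _; last by rewrite [v]thinmx0.
  by exists 0; rewrite [LHS]thinmx0 [RHS]thinmx0.
rewrite -[n.+1]/(1 + n)%N in K K0 KD KZ *.
have KB x y : K x -> K y -> K (x - y).
  by move=> Kx Ky; apply: KD => //; rewrite -scaleN1r; apply: KZ.
have [|x y|a x|k [c Hc]] := IH (fun v => K (row_mx 0 v)).
- by rewrite row_mx0.
- by move=> Kx Ky; rewrite -[0]add0r -add_row_mx; apply: KD.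
- by move=> Kx; rewrite -[0](scaler0 _ a) -scale_row_mx; apply: KZ.
have := @ideal_fg (fun a => exists v, K (row_mx a%:M v)).
case=> [|l [g Hg]].
  split=> [|x y [v Kv] [w Kw]|a x [v Kv]].
  - by exists 0; rewrite raddf0 row_mx0.
  - by exists (v + w); rewrite raddfD -add_row_mx; apply: KD.
  - by exists (a *: v); rewrite -scale_scalar_mx -scale_row_mx; apply: KZ.
have /choice[u Hu] : forall i, exists v, K (row_mx (g i)%:M v).
  move=> i; apply/Hg; exists (fun j => (j == i)%:R).
  rewrite (bigD1 i) //= eqxx mul1r big1 ?addr0 // => j /negPf->.
  by rewrite mul0r.
pose top := \matrix_i (row_mx (g i)%:M (u i) : 'rV_(1 + n)).
have KS m (w : 'rV_m) (c' : 'M_(m, 1 + n)) : (forall i, K (row i c')) ->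
    K (w *m c').
  move=> Hr; rewrite mulmx_sum_row; elim/big_rec: _ => // i x _ Kx.
  by apply: KD => //; apply: KZ.
exists (l + k)%N, (col_mx top (row_mx 0 c)) => v; split=> [Kv|[w ->]].
  have /Hg[d dE] : exists v', K (row_mx (v 0 0)%:M v').
    exists (rsubmx v); suff -> : (v 0 0)%:M = lsubmx v by rewrite hsubmxK.
    by rewrite [lsubmx v]mx11_scalar !mxE; congr (v _ _)%:M; apply: val_inj.
  pose dv := \row_i d i.
  have Kt : K (dv *m top) by apply: KS => i; rewrite rowK; apply: Hu.
  have /Hc[w wE] : K (row_mx 0 (rsubmx (v - dv *m top))).
    suff <- : lsubmx (v - dv *m top) = 0 by rewrite hsubmxK; apply: KB.
    apply/rowP => i; rewrite !mxE (_ : lshift n i = 0); last first.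
      by rewrite ord1; apply: val_inj.
    rewrite dE; apply/eqP; rewrite subr_eq0; apply/eqP/eq_bigr => j _.
    rewrite !mxE; case: splitP => [o _|o]; last by [].
    by rewrite ord1 !mxE eqxx.
  exists (row_mx dv w); rewrite mul_row_col mul_mx_row mulmx0 -wE.
  rewrite -[LHS](subrK (dv *m top)) addrC; congr (_ + _).
  suff {1}<- : lsubmx (v - dv *m top) = 0 by rewrite hsubmxK.
  apply/rowP => i; rewrite !mxE (_ : lshift n i = 0); last first.
    by rewrite ord1; apply: val_inj.
  rewrite dE; apply/eqP; rewrite subr_eq0; apply/eqP/eq_bigr => j _.
  rewrite !mxE; case: splitP => [o _|o]; last by [].
  by rewrite ord1 !mxE eqxx.
apply: KS => i; rewrite -[i]splitK; case: (split i) => j /=.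
  by rewrite rowKu rowK; apply: Hu.
rewrite rowKd row_row_mx row0; apply/Hc; exists (delta_mx 0 j).
by rewrite rowE.
Qed.

Lemma ker_fg n m (a : 'M[R]_(n, m)) : exists k (c : 'M_(k, n)), exmx c a.
Proof.
have [||x|k [c Hc]] := @submod_fg n (fun v => v *m a = 0).
- exact: mul0mx.
- by move=> x y xa ya; rewrite mulmxDl xa ya addr0.
- by move=> v va; rewrite -scalemxAl va scaler0.
by exists k, c.
Qed.

End Noetherian.

(** * Associated primes and maximal regular sequences *)

Section AssociatedPrimes.
Variable R : comNzRingType.
Hypothesis noeR : noetherian R.
Variables (J : R -> Prop) (HJ : is_ideal J).

(** [J : z] is maximal among the proper colon ideals; such ideals are prime. *)
Definition max_colon z := ~ J z /\
  forall z', ~ J z' -> (forall a, J (a * z) -> J (a * z')) ->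
    forall a, J (a * z') -> J (a * z).

Lemma colon_ideal z : is_ideal (fun a => J (a * z)).
Proof.
split=> [|x y Jx Jy|a x Jx]; first by rewrite mul0r; apply: id0.
  by rewrite mulrDl; apply: idD.
by rewrite -mulrA; apply: idM.
Qed.

Lemma max_colon_exists x z : ~ J z -> J (x * z) ->
  exists2 y, max_colon y & J (x * y).
Proof.
move=> nJz Jxz.
have [||I [y [nJy [Jxy ->]]] Hmax] := @noeth_max R noeR
  (fun I => exists y, ~ J y /\ J (x * y) /\ I = (fun a => J (a * y))).
- by move=> _ [y [_ [_ ->]]]; apply: colon_ideal.
- by exists (fun a => J (a * z)), z.
exists y => //; split=> // z' nJz' sub; apply: Hmax => //.
by exists z'; split=> //; split=> //; apply: sub.
Qed.

Lemma max_colon_prime z a b : max_colon z -> J (a * b * z) ->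
  J (a * z) \/ J (b * z).
Proof.
move=> [nJz zmax] Jabz; have [|nJbz] := pselect (J (b * z)); [by right|left].
apply: (zmax _ nJbz); last by rewrite mulrA.
by move=> c Jcz; rewrite mulrCA; apply: idM.
Qed.

(** A prime that contains none of finitely many ideals does not contain their
    intersection. *)
Lemma max_colon_prod z (zs : seq R) : max_colon z ->
  (forall z', z' \in zs -> exists2 b, J (b * z') & ~ J (b * z)) ->
  exists2 b, ~ J (b * z) & forall z', z' \in zs -> J (b * z').
Proof.
move=> Hz; elim: zs => [|z1 zs IH] Hzs.
  by exists 1; rewrite ?mul1r //; case: Hz.
have [|b nJb Hb] := IH; first by move=> z' z's; apply: Hzs; rewrite inE z's orbT.
have [c Jc nJc] := Hzs z1 (mem_head _ _).
exists (c * b); first by case/(max_colon_prime Hz).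
move=> z'; rewrite inE => /predU1P[->|/Hb Jz'].
  by rewrite mulrAC mulrC; apply: idM.
by rewrite -mulrA; apply: idM.
Qed.

(** Induction on the number of primes: an element outside all primes but [J : z]
    is corrected by a product lying in all of them but [J : z].  The latter
    exists because maximality makes the primes incomparable. *)
Lemma prime_avoidance (m : R -> Prop) (zs : seq R) : is_ideal m ->
  (forall z, z \in zs -> max_colon z) ->
  (forall z, z \in zs -> exists2 x, m x & ~ J (x * z)) ->
  exists2 x, m x & forall z, z \in zs -> ~ J (x * z).
Proof.
move=> Hm; elim: zs => [|z zs IH] Hmax Hzs; first by exists 0 => //; apply: id0.
have [z' z's|z' z's|x mx Hx] := IH.
- by apply: Hmax; rewrite inE z's orbT.
- by apply: Hzs; rewrite inE z's orbT.
have [Jxz|nJxz] := pselect (J (x * z)); last first.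
  by exists x => // z'; rewrite inE => /predU1P[->|/Hx].
have Hz : max_colon z by apply/Hmax/mem_head.
have [z' z's|b nJb Hb] := max_colon_prod (zs := zs) Hz.
  apply: contrapT => nb; apply: (Hx z' z's).
  have [] : max_colon z' by apply: Hmax; rewrite inE z's orbT.
  move=> _ /(_ z); apply=> //; first by case: Hz.
  by move=> b Jb; apply: contrapT => nJb; apply: nb; exists b.
have [y my nJy] := Hzs z (mem_head _ _).
exists (x + y * b); first by apply: idD => //; rewrite mulrC; apply: idM.
move=> z'; rewrite inE => /predU1P[->|z's] Jz.
  have : J (y * b * z).
    by rewrite -[_ * z](addKr (x * z)) -mulrDl; apply: idD => //; apply: idN.
  by case/(max_colon_prime Hz).
apply: (Hx z' z's); rewrite -[x](addrK (y * b)) mulrBl; apply: idB => //.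
by rewrite -mulrA; apply: idM => //; apply: Hb.
Qed.

Lemma addJs_colon (I : R -> Prop) (zs : seq R) z b :
  (forall y, I y -> J (b * y)) -> (forall z', z' \in zs -> J (b * z')) ->
  addJs I zs z -> J (b * z).
Proof.
elim: zs I => [|z1 zs IH] I HI Hb /=; first exact: HI.
apply: IH => [_ [c [d [Ic ->]]]|z' z's]; last first.
  by apply: Hb; rewrite inE z's orbT.
rewrite mulrDr mulrA [_ * d]mulrC; apply: idD => //; first exact: HI.
by apply: idM => //; apply/Hb/mem_head.
Qed.

(** Only finitely many colon ideals [J : z] are maximal: the elements [z]
    generate with [J] a finitely generated ideal, so each maximal colon ideal
    contains an intersection of finitely many of them, hence one of these.
    Prime avoidance then does the rest. *)
Lemma ideal_of_zero_divisors (m : R -> Prop) : is_ideal m ->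
  (forall x, m x -> exists2 z, ~ J z & J (x * z)) ->
  exists2 z, ~ J z & forall x, m x -> J (x * z).
Proof.
move=> Hm zd.
have [||I [zs [Hzs ->]] Imax] := @noeth_max R noeR
  (fun I => exists zs, (forall z, z \in zs -> max_colon z) /\ I = addJs J zs).
- by move=> _ [zs [_ ->]]; apply: addJs_ideal.
- by exists J, [::].
have gen z : max_colon z -> addJs J zs z.
  move=> Hz; apply: (Imax (addJs J (rcons zs z))).
  - exists (rcons zs z); split=> // z'; rewrite mem_rcons inE.
    by case/predU1P=> [->|/Hzs].
  - by move=> a; rewrite addJs_rcons; apply: sub_addJ.
  - by rewrite addJs_rcons; apply: addJ_gen; apply: addJs_ideal.
apply: contrapT => noz.
have [//|z z_s|x mx Hx] := @prime_avoidance m zs Hm.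
  apply: contrapT => nx; apply: noz; exists z; first by case: (Hzs z z_s).
  by move=> x mx; apply: contrapT => nJ; apply: nx; exists x.
have [y nJy Jxy] := zd x mx.
have [z Hz Jxz] := max_colon_exists nJy Jxy.
have [|b nJb Hb] := max_colon_prod (zs := zs) Hz.
  move=> z' z's; apply: contrapT => nb; apply: (Hx z' z's).
  have [_ /(_ z)] := Hzs z' z's; apply=> //; first by case: Hz.
  by move=> b Jb; apply: contrapT => nJb; apply: nb; exists b.
by apply: nJb; apply: addJs_colon (gen z Hz) => // c Jc; apply: idM.
Qed.

End AssociatedPrimes.

Section MaximalRegularSequence.
Variable R : comNzRingType.
Hypothesis noeR : noetherian R.

Definition null (a : R) : Prop := a = 0.

Lemma null_ideal : is_ideal null.
Proof.
split=> // [x y -> ->|a x ->]; rewrite /null ?addr0 //.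
exact: mulr0.
Qed.

Lemma inJ_null n m (A : 'M[R]_(n, m)) : inJ null A <-> A = 0.
Proof.
split=> [H|-> i j]; last by rewrite mxE.
by apply/matrixP => i j; rewrite mxE; apply: H.
Qed.

Lemma addJs_sub (m I : R -> Prop) (xs : seq R) : is_ideal m -> (forall a, I a -> m a) ->
  (forall x, x \in xs -> m x) -> forall a, addJs I xs a -> m a.
Proof.
move=> Hm; elim: xs I => [|x xs IH] I HI Hxs //=; apply: IH => [_ [b [c [Ib ->]]]|y ys].
  apply: idD => //; first exact: HI.
  by rewrite mulrC; apply: idM => //; apply/Hxs/mem_head.
by apply: Hxs; rewrite inE ys orbT.
Qed.

(** Among the ideals generated by regular sequences in [m] take a maximal one:
    no element of [m] is regular modulo it, so [m] kills a nonzero element of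
    the quotient. *)
Lemma max_regseq (m : R -> Prop) : is_ideal m -> ~ m 1 ->
  exists2 xs, (forall x, x \in xs -> m x) /\ regseq null xs &
    exists2 z, ~ addJs null xs z & forall x, m x -> addJs null xs (x * z).
Proof.
move=> Hm nm1.
have [||I [xs [mxs [rxs ->]]] Imax] := @noeth_max R noeR
  (fun I => exists xs, (forall x, x \in xs -> m x) /\ regseq null xs /\
     I = addJs null xs).
- by move=> _ [xs [_ [_ ->]]]; apply/addJs_ideal/null_ideal.
- by exists null, [::].
exists xs => //.
have HI : is_ideal (addJs null xs) by apply/addJs_ideal/null_ideal.
apply: (ideal_of_zero_divisors noeR) => // x mx.
apply: contrapT => nz.
have rx : regJ (addJs null xs) x.
  by move=> a Ja; apply: contrapT => nJa; apply: nz; exists a.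
have : addJs null xs x.
  apply: (Imax (addJs null (rcons xs x))); last 1 first.
  - by rewrite addJs_rcons; apply: addJ_gen.
  - exists (rcons xs x); split.
      by move=> y; rewrite mem_rcons inE => /predU1P[->|/mxs].
    by split=> //; apply/regseq_rcons.
  - by move=> a; rewrite addJs_rcons; apply: sub_addJ.
rewrite -[x in addJs _ _ x]mulr1 => /rx/(addJs_sub Hm) Jm; apply: nm1.
by apply: Jm => // a ->; apply: id0.
Qed.

End MaximalRegularSequence.

(** * Linear algebra over a local ring *)

Lemma field_of_inverses (Q : comNzRingType) :
  (forall y : Q, y <> 0 -> exists x, x * y = 1) ->
  exists (k : fieldType) (f : {rmorphism Q -> k}),
    injective f /\ forall y, exists x, f x = y.
Proof.
move=> Qinv'.
have Qinv (y : Q) : exists x : Q, if y == 0 then x = 0 else x * y = 1.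
  by case: eqP => [_|/Qinv'//]; exists 0.
have [inv Hinv] := choice Qinv.
have mulVf (y : Q) : y != 0 -> inv y * y = 1.
  by move=> /negPf y0; have := Hinv y; rewrite y0.
have invr0 : inv 0 = 0 by have := Hinv 0; rewrite eqxx.
pose k : fieldType :=
  HB.pack (GRing.ComNzRing.sort Q) (GRing.ComNzRing_isField.Build Q mulVf invr0).
by exists k, (idfun : {rmorphism Q -> Q}); split=> [//|y]; exists y.
Qed.

Section LocalLinearAlgebra.
Variables (A : comNzRingType) (m : idealr A).
Hypothesis unitA : forall a, a \notin m -> exists b, b * a = 1.

Let inm (a : A) : Prop := a \in m.

Lemma idealr_ideal (I : idealr A) : is_ideal (fun a => is_true (a \in I)).
Proof.
by split=> [|x y xm ym|a x xm]; [exact: rpred0|exact: rpredD|exact: idealMr].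
Qed.

Lemma residue_field : exists (k : fieldType) (f : {rmorphism A -> k}),
  (forall a, f a = 0 <-> a \in m) /\ forall y, exists a, f a = y.
Proof.
pose Q : comNzRingType := {ideal_quot m}.
have Q0 (a : A) : (\pi_{ideal_quot m}%qT a = 0 :> Q) <-> a \in m.
  have := Quotient.idealrBE m a 0; rewrite subr0 => ->.
  have p0 : \pi_{ideal_quot m}%qT 0 = 0 :> Q by exact: rmorph0.
  by split=> [H|/eqP ->//]; apply/eqP; rewrite H p0.
have Qsurj (y : Q) : exists a, \pi_{ideal_quot m}%qT a = y.
  by elim/quotW: y => a; exists a.
have [y y0|k [f [finj fsurj]]] := @field_of_inverses Q.
  have [a aE] := Qsurj y.
  have /unitA[b ba] : a \notin m by apply/negP => /Q0; rewrite aE.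
  by exists (\pi_{ideal_quot m}%qT b); rewrite -aE -rmorphM ba rmorph1.
exists k, (f \o (\pi_{ideal_quot m}%qT : {rmorphism A -> Q})); split=> [a|y].
  by rewrite /= -Q0; split=> [|->]; [rewrite -(rmorph0 f) => /finj|rewrite rmorph0].
have [x <-] := fsurj y; have [a <-] := Qsurj x; by exists a.
Qed.

(** Over the residue field the system [d *m g = e] has a solution as soon as
    [e] vanishes on the left kernel of [d]. *)
Lemma solve_mod_max n l r (d : 'M[A]_(n, l)) (e : 'M_(n, r)) :
  (forall v : 'rV_n, inJ inm (v *m d) -> inJ inm (v *m e)) ->
  exists g, inJ inm (d *m g - e).
Proof.
have [k [f [f0 fsurj]]] := residue_field.
have fin a b (B : 'M_(a, b)) : inJ inm B <-> map_mx f B = 0.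
  split=> [mB|/matrixP fB i j]; last by apply/f0; have := fB i j; rewrite !mxE.
  by apply/matrixP => i j; rewrite !mxE; apply/f0; apply: mB.
have lift a b (B : 'M[k]_(a, b)) : exists C, map_mx f C = B.
  have /choice[g Hg] : forall u : 'I_a * 'I_b, exists x, f x = B u.1 u.2.
    by move=> u; apply: fsurj.
  exists (\matrix_(i, j) g (i, j)); apply/matrixP => i j.
  by rewrite !mxE Hg.
move=> H.
have /submxP[g gE] : ((map_mx f e)^T <= (map_mx f d)^T)%MS.
  rewrite submxE; set c := cokermx _.
  have [C CE] := lift _ _ c^T.
  have Cd : map_mx f (C *m d) = 0.
    by rewrite map_mxM CE -[map_mx f d]trmxK -trmx_mul mulmx_coker trmx0.
  have : map_mx f (C *m e) = 0.
    move/fin: Cd => mCd; apply/fin => i j.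
    have mCi : inJ inm (row i C *m d).
      by move=> i' j'; rewrite -row_mul mxE; apply: mCd.
    by have := H _ mCi 0 j; rewrite -row_mul mxE.
  rewrite map_mxM CE => ce0; apply/eqP/trmx_inj.
  by rewrite trmx_mul trmx0 trmxK.
have [G GE] := lift _ _ g^T; exists G; apply/fin.
by rewrite map_mxB map_mxM GE -[map_mx f d]trmxK -trmx_mul -gE trmxK subrr.
Qed.

Lemma invertible_1D n (N : 'M[A]_n) : inJ inm N -> exists B, (1%:M + N) *m B = 1%:M.
Proof.
have [k [f [f0 _]]] := residue_field => mN.
have fN : map_mx f N = 0.
  by apply/matrixP => i j; rewrite !mxE; apply/f0; apply: mN.
have [|b bE] := unitA (a := \det (1%:M + N)).
  apply/negP => /f0; rewrite -det_map_mx map_mxD fN map_mx1 addr0 det1.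
  by move/eqP; rewrite oner_eq0.
exists (b *: \adj (1%:M + N)).
by rewrite -scalemxAr mul_mx_adj scale_scalar_mx bE.
Qed.

End LocalLinearAlgebra.

(** * Ring endomorphisms preserve acyclicity of finite free complexes *)

Section LocalAcyclicity.
Variables (A : comNzRingType) (m : idealr A).
Hypothesis noeA : noetherian A.
Hypothesis unitA : forall a, a \notin m -> exists b, b * a = 1.

(** Auslander-Buchsbaum: an acyclic complex that splits in high degrees splits
    above the depth.  The element [z] is a socle element of the ring modulo a
    maximal regular sequence: it shows that [a] is injective modulo [m] on the
    complement of its kernel, and linear algebra over the residue field lifts
    this to a splitting. *)
Lemma split_step k n r q (J : A -> Prop) z (b : 'M[A]_(q, k)) (c : 'M_(k, n))
    (a : 'M_(n, r)) :
  is_ideal J -> ~ J z -> (forall x, x \in m -> J (x * z)) ->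
  b *m c = 0 -> c *m a = 0 -> exmod J c a -> splitmx b c -> splitmx c a.
Proof.
move=> HJ nJz Jmz bc0 ca0 ex [h [x hx]].
have chc : c *m h *m c = c.
  by rewrite -[RHS]mul1mx -hx mulmxDl -[x *m b *m c]mulmxA bc0 mulmx0 addr0.
(* The projector along the image of [c]. *)
pose e := 1%:M - h *m c.
have ce : c *m e = 0 by rewrite mulmxBr mulmx1 mulmxA chc subrr.
have ea : e *m a = a by rewrite mulmxBl mul1mx -mulmxA ca0 mulmx0 subr0.
have ee : e *m e = e by rewrite {1}/e mulmxBl mul1mx -mulmxA ce mulmx0 subr0.
have [v mva|g mN] := @solve_mod_max _ _ unitA _ _ _ a e.
  have /ex[w Jw] : inJ J ((z *: v) *m a).
    by move=> i j; rewrite -scalemxAl mxE mulrC; apply: Jmz; apply: mva.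
  have Jve : inJ J (z *: (v *m e)).
    have -> : z *: (v *m e) = (z *: v - w *m c) *m e.
      by rewrite mulmxBl -mulmxA ce mulmx0 subr0 scalemxAl.
    exact: inJMr.
  move=> i j; apply: contrapT => /negP/unitA[u uE]; apply: nJz.
  rewrite -[z]mul1r -uE -mulrA [_ * z]mulrC; apply: idM => //.
  by have := Jve i j; rewrite mxE.
set N := _ - e in mN.
have [|B BE] := @invertible_1D _ _ unitA _ (N *m e).
  by apply: inJMr => //; apply: idealr_ideal.
have agE : a *m g = e + N by rewrite addrC subrK.
have age : a *m g *m e = e *m (1%:M + N *m e).
  have {1}-> : a *m g *m e = e *m (a *m g *m e) by rewrite !mulmxA ea.
  by rewrite agE [(e + N) *m e]mulmxDl ee [in RHS]mulmxDr mulmx1 mulmxDr ee.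
exists (g *m e *m B), h.
by rewrite !mulmxA age -mulmxA BE mulmx1 subrK.
Qed.

Lemma split_down C s r (J : A -> Prop) z :
  is_ideal J -> ~ J z -> (forall x, x \in m -> J (x * z)) -> is_cpx C ->
  (forall i, (r <= i)%N -> exmod J (dif C i.+1) (dif C i)) ->
  split_from s C -> split_from r C.
Proof.
move=> HJ nJz Jmz HC ex; elim: s => [|s IH] Hs; first by move=> i _; apply: Hs.
have [rs|sr] := leqP r s; last by move=> i ri; apply/Hs/(leq_trans sr).
apply: IH => i; rewrite leq_eqVlt => /predU1P[<-|/Hs//].
apply: (split_step HJ nJz Jmz (HC s.+1) (HC s)); first exact: ex.
exact: Hs.
Qed.

(** Any endomorphism [f] of the ring preserves the splitting of [C] above the
    depth, so that the image of [C] is short enough for the acyclicity lemma. *)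
Lemma local_acyclic (f : {rmorphism A -> A}) (C : cpx A) s :
  is_cpx C -> exact_from 0 C -> split_from s C ->
  (forall x, x \in m -> forall (i : nat) (v : 'rV[A]_(rk C i.+1)),
     v *m map_mx f (dif C i) = 0 ->
     exists N w, x ^+ N *: v = w *m map_mx f (dif C i.+1)) ->
  exact_from 0 (cmap f C).
Proof.
move=> HC Cex Cs tor.
have [|xs [mxs rxs] [z nJz Jmz]] := max_regseq noeA (idealr_ideal m).
  by rewrite idealr1.
have N0 := null_ideal A; have HJ := addJs_ideal xs N0.
have Csplit : split_from (size xs) C.
  apply: (split_down HJ nJz Jmz HC) Cs => i Hi.
  apply: (exmod_addJs N0 rxs HC (s := 0)); last by rewrite addn0.
  move=> j _ v /inJ_null/(Cex j isT)[w ->]; exists w.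
  by apply/inJ_null; rewrite subrr.
have fC := cmap_cpx f HC.
move=> i _; apply: exmxP; first exact: fC.
move=> v v0; have [|x xxs j _ u /inJ_null u0||w] :=
  @acyclicity _ _ xs (cmap f C) 0 N0 rxs fC _ _ i isT v _.
- by rewrite addn0; apply: cmap_split.
- have [N [w Hw]] := tor x (mxs x xxs) j u u0; exists N, w.
  by apply/inJ_null; rewrite Hw subrr.
- by apply/inJ_null.
- by move=> /inJ_null/eqP; rewrite subr_eq0 => /eqP vE; exists w.
Qed.

End LocalAcyclicity.

(** * Localization of matrices *)

Section LocalizationMap.
Variables (R : comNzRingType) (q : prime_idealr R).
Let A : comNzRingType := loc_ring q.

Definition locm (a : R) : loc_ring q := loc_frac a (denom1 q).

Lemma locm_zmod : zmod_morphism locm.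
Proof.
move=> a b; rewrite /locm [in RHS](_ : - loc_frac b _ = loc_frac (- b) (denom1 q)).
  by rewrite loc_fracD; apply: loc_frac_eq1; rewrite ?dvalE /=; ring.
exact: (@loc_oppE R q R^o).
Qed.
Lemma locm_monoid : monoid_morphism locm.
Proof.
split=> // a b; rewrite [RHS]loc_mulE.
by apply: loc_frac_eq1; rewrite ?dvalE /=; ring.
Qed.
HB.instance Definition _ := GRing.isZmodMorphism.Build R (loc_ring q) locm locm_zmod.
HB.instance Definition _ := GRing.isMonoidMorphism.Build R (loc_ring q) locm locm_monoid.

Lemma loc_fracE a s : loc_frac a s = locm a * loc_frac 1 s.
Proof. by rewrite [RHS]loc_mulE; apply: loc_frac_eq1; rewrite ?dvalE /=; ring. Qed.

Lemma locm_inv s : s \notin q -> exists y, y * locm s = 1.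
Proof.
move=> sq; exists (loc_frac 1 (exist _ s sq : denom q)).
rewrite [LHS]loc_mulE; apply: loc_frac_eq1.
by rewrite ?dvalE /dval /= ?mulr1 ?mul1r.
Qed.

Lemma locm_eq0 a : locm a = 0 <-> exists2 s, s \notin q & s * a = 0.
Proof.
split=> [/loc_frac_eq[u]|[s sq sa0]].
  rewrite ?dvalE !mulr1 mulr0 => ua0; exists (dval u) => //; exact: dvalP.
have [y y1] := locm_inv sq.
by rewrite -[LHS]mul1r -y1 -mulrA -rmorphM /= sa0 rmorph0 mulr0.
Qed.

(** A product of denominators for the single conditions serves for all of them,
    and it lies outside [q] because [q] is prime. *)
Lemma common_denom (I : finType) (P : I -> R -> Prop) :
  (forall i s t, P i s -> P i (t * s)) ->
  (forall i, exists2 s, s \notin q & P i s) ->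
  exists2 s, s \notin q & forall i, P i s.
Proof.
move=> PM /(_ _)/cid2 ex; pose f i := s2val (ex i).
exists (\prod_i f i).
  elim/big_rec: _ => [|i x _ xq]; first by rewrite idealr1.
  by rewrite prime_idealrM negb_or xq (s2valP (ex i)).
by move=> i; rewrite (bigD1 i) //= mulrC; apply/PM/(s2valP' (ex i)).
Qed.

Lemma locm_mx_num n m (V : 'M[A]_(n, m)) :
  exists2 s, s \notin q & exists v, locm s *: V = map_mx locm v.
Proof.
have [[i j] s t [a aE]|[i j]|s sq Hs] :=
  @common_denom ('I_n * 'I_m)%type (fun u s => exists a, locm s * V u.1 u.2 = locm a).
- by exists (t * a); rewrite !rmorphM /= -mulrA aE.
- case: (loc_ringP (V i j)) => a s; exists (dval s); first exact: dvalP.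
  exists a; rewrite [LHS]loc_mulE.
  by apply: loc_frac_eq1; rewrite ?dvalE /=; ring.
have [f Hf] := choice Hs; exists s => //.
by exists (\matrix_(i, j) f (i, j)); apply/matrixP => i j; rewrite !mxE -Hf.
Qed.

Lemma locm_mx_eq0 n m (v : 'M[R]_(n, m)) :
  map_mx locm v = 0 -> exists2 s, s \notin q & s *: v = 0.
Proof.
move=> /matrixP v0; have [[i j] s t H|[i j]|s sq Hs] :=
  @common_denom ('I_n * 'I_m)%type (fun u s => s * v u.1 u.2 = 0).
- by rewrite -mulrA H mulr0.
- by apply/locm_eq0; have := v0 i j; rewrite !mxE.
exists s => //; apply/matrixP => i j; rewrite !mxE; exact: (Hs (i, j)).
Qed.

Lemma map_mxZ_locm n m s (v : 'M[R]_(n, m)) :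
  map_mx locm (s *: v) = locm s *: map_mx locm v.
Proof. by apply/matrixP => i j; rewrite !mxE rmorphM. Qed.

(** Localization is exact. *)
Lemma exmx_loc k n m (c : 'M[R]_(k, n)) (a : 'M_(n, m)) :
  exmx c a -> exmx (map_mx locm c) (map_mx locm a).
Proof.
move=> ex; apply: exmxP; first by rewrite -map_mxM (exmx_mul0 ex) map_mx0.
move=> V Va0; have [s sq [v vE]] := locm_mx_num V.
have /locm_mx_eq0[t tq] : map_mx locm (v *m a) = 0.
  by rewrite map_mxM -vE -scalemxAl Va0 scaler0.
rewrite scalemxAl => /ex[w wE].
have [y y1] := locm_inv sq; have [z z1] := locm_inv tq.
exists ((y * z) *: map_mx locm w); rewrite -scalemxAl -map_mxM -wE map_mxZ_locm.
rewrite -vE !scalerA; set c1 := (X in X *: V).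
have -> : c1 = (y * locm s) * (z * locm t) by rewrite /c1; ring.
by rewrite y1 z1 mulr1 scale1r.
Qed.

Lemma loc_noetherian : noetherian R -> noetherian A.
Proof.
move=> noeR I Isub.
have IZ (a x : A) : x \in I -> a * x \in I.
  have [I0 IP] := Isub => xI.
  by have := IP a x 0 xI I0; rewrite addr0.
have ID (x y : A) : x \in I -> y \in I -> x + y \in I.
  have [_ IP] := Isub => xI yI; have := IP 1 x y xI yI.
  by rewrite scale1r.
have [|k [g Hg]] := ideal_fg noeR (J := fun a => is_true (locm a \in I)).
  split=> [|x y xI yI|a x xI]; rewrite ?rmorph0 ?rmorphD ?rmorphM.
  - by case: Isub.
  - exact: ID.
  - exact: IZ.
exists k, (fun i => locm (g i)) => x; split=> [|[c ->]].
  case: (loc_ringP x) => a s xI.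
  have /Hg[c cE] : locm a \in I.
    suff -> : locm a = locm (dval s) * loc_frac a s by apply: IZ.
    by rewrite [RHS]loc_mulE; apply: loc_frac_eq1; rewrite ?dvalE /=; ring.
  exists (fun i => loc_frac 1 s * locm (c i)).
  rewrite loc_fracE cE rmorph_sum mulr_suml; apply: eq_bigr => i _.
  by rewrite rmorphM mulrC mulrA.
elim/big_rec: _ => [|i x' _ xI]; first by case: Isub.
apply: ID => //; apply: IZ; apply/Hg; exists (fun j => (j == i)%:R).
rewrite (bigD1 i) //= eqxx mul1r big1 ?addr0 // => j /negPf->.
by rewrite mul0r.
Qed.

Definition loc_max : {pred loc_ring q} :=
  [pred x | `[< exists a s, a \in q /\ x = loc_frac a s >]].

Lemma loc_maxP a s : (loc_frac a s \in loc_max) = (a \in q).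
Proof.
apply/asboolP/idP => [[b [t [bq /loc_frac_eq[u uE]]]]|aq]; last by exists a, s.
have : dval u * dval t * a \in q by rewrite uE; apply: idealMr.
by rewrite !prime_idealrM !(negPf (dvalP _)).
Qed.

Lemma loc_max_idealr : idealr_closed loc_max.
Proof.
split.
- by rewrite -[0]/(loc_frac 0 (denom1 q)) loc_maxP rpred0.
- by rewrite -[1]/(loc_frac 1 (denom1 q)) loc_maxP idealr1.
- move=> x y z; case: (loc_ringP x) => a s; case: (loc_ringP y) => b t.
  case: (loc_ringP z) => c u; rewrite [_ * _]loc_mulE loc_fracD !loc_maxP.
  by move=> bq cq; rewrite rpredD //; apply: idealMr => //; apply: idealMr.
Qed.

HB.instance Definition _ := isIdealr.Build (loc_ring q) loc_max loc_max_idealr.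

Lemma loc_max_unit (x : loc_ring q) : x \notin loc_max -> exists y, y * x = 1.
Proof.
case: (loc_ringP x) => a s; rewrite loc_maxP => aq.
exists (loc_frac (dval s) (exist _ a aq : denom q)); rewrite [LHS]loc_mulE.
by apply: loc_frac_eq1; rewrite ?dvalE /dval /=; ring.
Qed.

Lemma frob_loc p (hp : p \in [pchar R]) n k l (v : 'M_(k, l)) :
  map_mx (frob n (loc_pchar q hp)) (map_mx locm v) =
  map_mx locm (map_mx (frob n hp) v).
Proof. by apply/matrixP => i j; rewrite !mxE /frob rmorphXn. Qed.

End LocalizationMap.

(** * The Frobenius functor preserves finite free resolutions *)

Section PeskineSzpiro.
Variables (R : comNzRingType) (p : nat) (hp : p \in [pchar R]) (n : nat).
Hypothesis noeR : noetherian R.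

Lemma radical_ideal (I : R -> Prop) : is_ideal I ->
  is_ideal (fun a => exists N, I (a ^+ N)).
Proof.
move=> HI; split=> [|x y [k Ix] [l Iy]|a x [k Ix]].
- by exists 1%N; rewrite expr1; apply: id0.
- exists (k + l)%N; rewrite exprDn; apply: id_sum => // i.
  rewrite -mulr_natl; apply: idM => //.
  have [li|/ltnW il] := leqP l i.
    by rewrite -(subnK li) exprD mulrA; apply: idM.
  by rewrite -addnBA // exprD -mulrA mulrC; apply: idM.
- by exists k; rewrite exprMn; apply: idM.
Qed.

(** [rad I : y] is prime when it is maximal among the proper ideals of this
    form, and then every element of it becomes nilpotent modulo [I] after
    inverting [y]. *)
Lemma prime_over (I : R -> Prop) : is_ideal I -> ~ I 1 ->
  exists q : prime_idealr R, (forall a, I a -> a \in q) /\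
    exists2 y, y \notin q & forall a, a \in q -> exists N, I ((y * a) ^+ N).
Proof.
move=> HI nI1; have HJ := radical_ideal HI; set J := (fun _ => _) in HJ.
have nJ1 : ~ J 1 by case=> N; rewrite expr1n.
have [|y Hy _] := @max_colon_exists _ noeR _ HJ 0 1 nJ1.
  by rewrite mul0r; apply: id0.
have nJy : ~ J y by case: Hy.
pose P : {pred R} := [pred a | `[< J (a * y) >]].
have Pcl : idealr_closed P.
  split; rewrite ?inE.
  - by apply/asboolP; rewrite mul0r; apply: id0.
  - by apply/asboolP; rewrite mul1r.
  - move=> a x z /asboolP Jx /asboolP Jz; apply/asboolP.
    by rewrite mulrDl -mulrA; apply: idD => //; apply: idM.
have Ppr : prime_idealr_closed P.
  move=> a b /asboolP/(max_colon_prime HJ Hy)[] H; apply/orP; [left|right];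
    exact/asboolP.
pose q : prime_idealr R := HB.pack (P : R -> bool) (isIdealr.Build R P Pcl)
  (isPrimeIdealrClosed.Build R P Ppr).
exists q; split=> [a Ia|].
  by apply/asboolP; rewrite mulrC; apply: idM => //; exists 1%N; rewrite expr1.
exists y; last by move=> a /asboolP[N aN]; exists N; rewrite mulrC.
apply/negP => /asboolP[N]; rewrite -expr2 -exprM => JN; apply: nJy.
by exists (2 * N)%N.
Qed.

Let f := frob n hp.

(** By induction on the length only the homology in degree [1] remains to be
    killed.  If it is nonzero, [prime_over] applied to its annihilator [I] gives
    a prime at which it is torsion but nonzero, contradicting
    [local_acyclic]. *)
Lemma peskine_szpiro (C : cpx R) s :
  is_cpx C -> exact_from 0 C -> split_from s C -> exact_from 0 (cmap f C).
Proof.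
elim: s C => [|s IH] C HC Cex Cs.
  by move=> i _; apply/split_exmx/cmap_split/leq0n => //; apply: cmap_cpx.
have fC := cmap_cpx f HC.
have ex1 : forall i, exmx (dif (cmap f C) i.+2) (dif (cmap f C) i.+1).
  move=> i; apply: (IH (cshift C)) => //.
  - by move=> j; apply: HC.
  - by move=> j _; apply: Cex.
  - by move=> j sj; apply: Cs.
case=> [|i] _; last exact: ex1.
set d0 := dif (cmap f C) 0; set d1 := dif (cmap f C) 1.
(* The rows of [Z] generate the cycles of degree [1]. *)
have [k [Z Zex]] := ker_fg noeR d0.
pose I a := exists Y, a *: Z = Y *m d1.
have HI : is_ideal I.
  split=> [|x y [X HX] [Y HY]|a x [X HX]].
  - by exists 0; rewrite scale0r mul0mx.
  - by exists (X + Y); rewrite scalerDl mulmxDl HX HY.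
  - by exists (a *: X); rewrite -scalerA HX scalemxAl.
apply: exmxP; first exact: fC.
suff [Y YE] : I 1.
  by move=> v /Zex[w ->]; exists (w *m Y); rewrite -mulmxA -YE scale1r.
apply: contrapT => nI1; have [q [Iq [y yq Hq]]] := prime_over HI nI1.
pose fA := frob n (loc_pchar q hp).
have dE i : map_mx fA (dif (cmap (locm q) C) i) = map_mx (locm q) (dif (cmap f C) i).
  exact: frob_loc.
have exA i : exmx (map_mx (locm q) (dif (cmap f C) i.+2))
                  (map_mx (locm q) (dif (cmap f C) i.+1)) by apply/exmx_loc/ex1.
have Acex : exact_from 0 (cmap fA (cmap (locm q) C)).
  have LA := @local_acyclic (loc_ring q) (@loc_max R q : idealr (loc_ring q))
    (loc_noetherian noeR) (@loc_max_unit R q) fA (cmap (locm q) C) s.+1.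
  apply: LA.
  - exact: cmap_cpx.
  - by move=> i _; apply/exmx_loc/Cex.
  - exact: cmap_split.
  move=> x + [|i] V; rewrite !dE => xm V0; last first.
    by have /exA[w ->] := V0; exists 0%N, w; rewrite expr0 scale1r.
  have /(exmx_loc (q := q))/(_ V)[/(_ V0)[W WE] _] := Zex.
  case: (loc_ringP x) xm => a t; rewrite loc_maxP => /Hq[N [Y YE]].
  have [y' y'1] := locm_inv yq.
  exists N, ((loc_frac 1 t ^+ N * y' ^+ N) *: (W *m map_mx (locm q) Y)).
  rewrite -scalemxAl -mulmxA -map_mxM -YE map_mxZ_locm -scalemxAr -WE scalerA.
  congr (_ *: _); rewrite loc_fracE rmorphXn rmorphM !exprMn /=.
  have e : y' ^+ N * locm q y ^+ N = 1 by rewrite -exprMn y'1 expr1n.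
  by rewrite -[LHS]mulr1 -e; ring.
have exA0 : exmx (map_mx (locm q) d1) (map_mx (locm q) d0).
  by rewrite -!dE; apply: Acex.
have [Y' Y'E] : exists Y', map_mx (locm q) Z = Y' *m map_mx (locm q) d1.
  apply: (exmx_factor exA0).
  by rewrite -map_mxM (exmx_mul0 Zex) map_mx0.
have [u uq [Y YE]] := locm_mx_num Y'.
have /locm_mx_eq0[v vq] : map_mx (locm q) (u *: Z - Y *m d1) = 0.
  rewrite map_mxB map_mxZ_locm map_mxM -YE -scalemxAl -Y'E.
  exact: subrr.
rewrite scalerBr scalerA => /eqP; rewrite subr_eq0 scalemxAl => /eqP vE.
have : v * u \in q by apply: Iq; exists (v *: Y).
by rewrite prime_idealrM (negPf vq) (negPf uq).
Qed.

End PeskineSzpiro.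

(** * Quotient modules and lifting of linear maps *)

Section LinearMaps.
Variable R : comNzRingType.

Definition lin_of (U V : lmodType R) (f : U -> V) (Hf : linear f) :
    {linear U -> V} :=
  HB.pack f (GRing.isLinear.Build R U V *:%R f Hf).

Record is_submod (V : lmodType R) (K : V -> Prop) : Prop := IsSubmod {
  sm0 : K 0;
  smD : forall x y, K x -> K y -> K (x + y);
  smZ : forall a x, K x -> K (a *: x) }.

Lemma ker_submod (V W : lmodType R) (f : {linear V -> W}) :
  is_submod (fun x => f x = 0).
Proof.
split=> [|x y fx fy|a x fx]; first exact: linear0.
  by rewrite linearD fx fy addr0.
by rewrite linearZ /= fx scaler0.
Qed.

Lemma im_submod (V W : lmodType R) (f : {linear V -> W}) :
  is_submod (fun y => exists x, y = f x).
Proof.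
split=> [|_ _ [x ->] [y ->]|a _ [x ->]]; first by exists 0; rewrite linear0.
  by exists (x + y); rewrite linearD.
by exists (a *: x); rewrite linearZ.
Qed.

End LinearMaps.

Section Quotient.
Local Open Scope quotient_scope.
Variables (R : comNzRingType) (V : lmodType R) (K : V -> Prop).
Hypothesis HK : is_submod K.

Definition quo_rel (x y : V) : bool := `[< K (x - y) >].

Lemma quo_rel_equiv : equiv_class_of quo_rel.
Proof.
split=> [x|x y|y x z].
- by apply/asboolP; rewrite subrr; apply: sm0.
- by apply/asboolP/asboolP; rewrite -opprB -scaleN1r => /(smZ HK (-1));
    rewrite scaleN1r ?opprK // scaleN1r opprK.
- move=> /asboolP Kxy /asboolP Kyz; apply/asboolP.
  by rewrite -(subrK y x) -addrA; apply: smD.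
Qed.

Canonical quo_equiv := EquivRelPack quo_rel_equiv.
Canonical quo_encModRel := defaultEncModRel quo_rel.

Definition quo : Type := {eq_quot quo_rel}.
Local Notation Q := quo.
HB.instance Definition _ : EqQuotient _ quo_rel Q := EqQuotient.on Q.
HB.instance Definition _ := Choice.on Q.

Lemma quo_eq (x y : V) : \pi_Q x = \pi_Q y <-> K (x - y).
Proof. by split=> [/eqmodP/asboolP|H] //; apply/eqmodP/asboolP. Qed.

Lemma quo_repr (x : V) : K (repr (\pi_Q x) - x).
Proof. by apply/quo_eq; rewrite reprK. Qed.

Lemma quoP (y : Q) : exists x, y = \pi_Q x.
Proof. by exists (repr y); rewrite reprK. Qed.

Definition quo_add (x y : Q) : Q := \pi_Q (repr x + repr y).
Definition quo_scale a (x : Q) : Q := \pi_Q (a *: repr x).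

Lemma quo_addE x y : quo_add (\pi_Q x) (\pi_Q y) = \pi_Q (x + y).
Proof. by apply/quo_eq; rewrite opprD addrACA; apply: smD => //; apply: quo_repr. Qed.
Lemma quo_scaleE a x : quo_scale a (\pi_Q x) = \pi_Q (a *: x).
Proof. by apply/quo_eq; rewrite -scalerBr; apply: smZ => //; apply: quo_repr. Qed.

Lemma quo_addA : associative quo_add.
Proof.
move=> x y z; case: (quoP x) (quoP y) (quoP z) => {}x -> [{}y ->] [{}z ->].
by rewrite !quo_addE addrA.
Qed.
Lemma quo_addC : commutative quo_add.
Proof. by move=> x y; case: (quoP x) (quoP y) => {}x -> [{}y ->]; rewrite !quo_addE addrC. Qed.
Lemma quo_add0 : left_id (\pi_Q 0) quo_add.
Proof. by move=> x; case: (quoP x) => {}x ->; rewrite quo_addE add0r. Qed.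
Lemma quo_addN : left_inverse (\pi_Q 0) (quo_scale (-1)) quo_add.
Proof. by move=> x; case: (quoP x) => {}x ->; rewrite quo_scaleE quo_addE scaleN1r addNr. Qed.
HB.instance Definition _ :=
  GRing.isZmodule.Build Q quo_addA quo_addC quo_add0 quo_addN.

Lemma quo_piD (x y : V) : \pi_Q x + \pi_Q y = \pi_Q (x + y).
Proof. exact: quo_addE. Qed.

Lemma quo_scaleA a b x : quo_scale a (quo_scale b x) = quo_scale (a * b) x.
Proof. by case: (quoP x) => {}x ->; rewrite !quo_scaleE scalerA. Qed.
Lemma quo_scale1 : left_id 1 quo_scale.
Proof. by move=> x; case: (quoP x) => {}x ->; rewrite quo_scaleE scale1r. Qed.
Lemma quo_scaleDr : right_distributive quo_scale +%R.
Proof.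
move=> a x y; case: (quoP x) (quoP y) => {}x -> [{}y ->].
by rewrite quo_piD !quo_scaleE quo_piD scalerDr.
Qed.
Lemma quo_scaleDl x : {morph quo_scale^~ x : a b / a + b}.
Proof.
by move=> a b; case: (quoP x) => {}x ->; rewrite !quo_scaleE quo_piD scalerDl.
Qed.
HB.instance Definition _ := GRing.Zmodule_isLmodule.Build R Q
  quo_scaleA quo_scale1 quo_scaleDr quo_scaleDl.

Lemma quo_pi_linear : linear (\pi_Q : V -> Q).
Proof.
by move=> a x y; rewrite -quo_piD -quo_scaleE.
Qed.
Definition quo_pi : {linear V -> Q} := lin_of quo_pi_linear.

Lemma quo_piP x : quo_pi x = 0 <-> K x.
Proof. by rewrite -[x in K x]subr0; exact: quo_eq. Qed.

Lemma quo_surj (y : Q) : exists x, quo_pi x = y.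
Proof. by case: (quoP y) => x ->; exists x. Qed.

Lemma quo_lift (W : lmodType R) (f : {linear V -> W}) :
  (forall x, K x -> f x = 0) ->
  exists g : {linear Q -> W}, forall x, g (quo_pi x) = f x.
Proof.
move=> Hf.
have gE x : f (repr (quo_pi x)) = f x.
  by apply/eqP; rewrite -subr_eq0 -linearB; apply/eqP/Hf/quo_repr.
have glin : linear (fun y : Q => f (repr y)).
  move=> a x y; case: (quoP x) (quoP y) => {}x -> [{}y ->].
  rewrite -![\pi_Q _]/(quo_pi _) -linearP !gE.
  by rewrite linearP.
by exists (lin_of glin).
Qed.

End Quotient.

Section Lifting.
Variable R : comNzRingType.

(** The condition on kernels lets [h] descend to the image of [g], modelled as
    the quotient by the kernel of [g], and injectivity extends it from there. *)
Lemma injective_extend (E U V : lmodType R) (g : {linear U -> V})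
    (h : {linear U -> E}) :
  injective_module E -> (forall x, g x = 0 -> h x = 0) ->
  exists h' : {linear V -> E}, forall x, h' (g x) = h x.
Proof.
move=> injE Hh; have HK := ker_submod g.
have [g' Hg'] := quo_lift HK (f := g) (fun x H => H).
have [h1 Hh1] := quo_lift HK Hh.
have [|h' Hh'] := injE _ _ g' h1.
  move=> x y; have [x' <-] := quo_surj x; have [y' <-] := quo_surj y.
  rewrite !Hg' => xy; apply/eqP; rewrite -subr_eq0 -linearB; apply/eqP/quo_piP.
  by rewrite linearB xy subrr.
by exists h' => x; rewrite -Hg' Hh' Hh1.
Qed.

(** Projectivity is applied to the surjection of [A] onto its quotient by the
    kernel of [g], through which [f] factors. *)
Lemma projective_lift (P A B : lmodType R) (f : {linear P -> B})
    (g : {linear A -> B}) :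
  projective P -> (forall x, exists a, g a = f x) ->
  exists f' : {linear P -> A}, forall x, g (f' x) = f x.
Proof.
move=> projP /choice[s Hs]; have HK := ker_submod g.
have hlin : linear (fun x => quo_pi HK (s x)).
  move=> a x y; rewrite -linearP; apply/eqP; rewrite -subr_eq0 -linearB.
  by apply/eqP/quo_piP; rewrite linearB Hs [g (_ + _)]linearP !Hs linearP subrr.
have [|f' Hf'] := projP _ _ (quo_pi HK) (lin_of hlin); first exact: quo_surj.
exists f' => x; rewrite -Hs; apply/eqP; rewrite -subr_eq0 -linearB.
apply/eqP/(quo_piP HK); rewrite linearB; apply/eqP; rewrite subr_eq0; apply/eqP.
exact: Hf'.
Qed.

Lemma row_linear n (V : lmodType R) (b : 'I_n -> V) :
  exists f : {linear 'rV[R]_n -> V}, forall v, f v = \sum_i v 0 i *: b i.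
Proof.
have flin : linear (fun v : 'rV[R]_n => \sum_i v 0 i *: b i).
  move=> a x y; rewrite scaler_sumr -big_split; apply: eq_bigr => i _ /=.
  by rewrite !mxE scalerDl scalerA.
by exists (lin_of flin).
Qed.

Lemma free_projective n : projective ('rV[R]_n : lmodType R).
Proof.
move=> A B g h surj; have /choice[s Hs] := fun i => surj (h (delta_mx 0 i)).
have [f Hf] := row_linear s; exists f => x.
rewrite Hf linear_sum [in RHS](row_sum_delta x) linear_sum.
by apply: eq_bigr => i _; rewrite !linearZ Hs.
Qed.

Lemma row_linear_mx n m (f : {linear 'rV[R]_n -> 'rV[R]_m}) :
  exists M, forall v, f v = v *m M.
Proof. by exists (lin1_mx f) => v; rewrite mul_rV_lin1. Qed.

End Lifting.

(** * Duals of exact complexes over a ring of finite injective dimension *)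

Section GorensteinDuality.
Variable R : comNzRingType.

(** The exact sequence ending with [a] continues by [s] further steps, so that
    the image of [a] is an [s]-th syzygy. *)
Fixpoint cosyzygy (s n m : nat) (a : 'M[R]_(n, m)) : Prop :=
  if s is s'.+1 then
    exists l (b : 'M_(m, l)), exmx a b /\ cosyzygy s' b
  else True.

(** Dimension shifting.  Since [E l] is injective, [w] extends along [a]; the
    differential of the extension is a map to [E l.+1] of the same kind, one step
    further along the free modules, and by induction it can be corrected.  The
    induction ends where the injective resolution does. *)
Lemma exact_dual_step (E : inj_resolution (R^o : lmodType R)) k :
  (forall i, (k < i)%N -> forall x : E i, x = 0) ->
  forall j l, (l + j = k)%N -> forall r n m (c : 'M[R]_(r, n)) (a : 'M_(n, m))
    (w : {linear 'rV[R]_n -> E l}),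
  exmx c a -> cosyzygy j a -> (forall v, ires_d E l (w v) = 0) ->
  (forall v, w (v *m c) = 0) ->
  exists u : {linear 'rV[R]_m -> E l},
    (forall v, u (v *m a) = w v) /\ forall v, ires_d E l (u v) = 0.
Proof.
move=> E0; elim=> [|j IH] l ljk r n m c a w ex.
  move=> _ _ wc; have [|u Hu] := injective_extend (g := mulmxr a) (@ires_inj _ _ E l) (h := w).
    by move=> v /= /ex[v' ->].
  by exists u; split=> // v; apply: E0; rewrite -ljk addn0.
move=> [m' [b [exb cosb]]] dw wc.
have [|u Hu] := injective_extend (g := mulmxr a) (@ires_inj _ _ E l) (h := w).
  by move=> v /= /ex[v' ->].
have [||v|u2 [Hu2 du2]] := IH l.+1 _ _ _ _ a b (ires_d E l \o u) exb cosb.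
- by rewrite addSnnS.
- by move=> v /=; apply/(@ires_exact _ _ E l _); exists (u v).
- by rewrite /= (Hu v) dw.
have [|f Hf] := projective_lift (f := u2) (g := ires_d E l) (@free_projective R m').
  by move=> x; apply/(@ires_exact _ _ E l _)/du2.
exists (u \- (f \o mulmxr b)); split=> v /=.
  have -> : v *m a *m b = 0 by rewrite -mulmxA (exmx_mul0 exb) mulmx0.
  by rewrite linear0 subr0 (Hu v).
by rewrite linearB /= Hf Hu2 subrr.
Qed.

(** The vanishing of Ext to [R] on high syzygies. *)
Lemma exact_dual : finite_id (R^o : lmodType R) ->
  exists k, forall r n m (c : 'M[R]_(r, n)) (a : 'M_(n, m)),
    exmx c a -> cosyzygy k a -> exmx a^T c^T.
Proof.
case=> E [k E0]; exists k => r n m c a ex cos; apply: exmxP.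
  by rewrite -trmx_mul (exmx_mul0 ex) trmx0.
move=> w wc0.
have wlin : linear (fun v : 'rV[R]_n => ires_aug E ((v *m w^T) 0 0)).
  move=> x v v'; rewrite mulmxDl -scalemxAl !mxE.
  exact: linearP.
have wc v : v *m c *m w^T = 0.
  by rewrite -mulmxA -[c]trmxK -trmx_mul wc0 trmx0 mulmx0.
have [//|v|v|u [Hu du]] := exact_dual_step (l := 0) E0 _ (w := lin_of wlin) ex cos.
- by apply/(@ires_exact0 _ _ E _); exists ((v *m w^T) 0 0).
- by rewrite /= wc mxE linear0.
have /choice[u0 Hu0] : forall i, exists x : R, ires_aug E x = u (delta_mx 0 i).
  by move=> i; apply/(@ires_exact0 _ _ E _)/du.
exists (\row_i u0 i); apply/rowP => i; apply: (@ires_aug_inj _ _ E).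
transitivity (u (delta_mx 0 i *m a)).
  by rewrite Hu /= -rowE !mxE.
rewrite -rowE (row_sum_delta (row i a)) linear_sum !mxE.
rewrite (linear_sum (ires_aug E)); apply: eq_bigr => j _.
rewrite linearZ /= -Hu0 !mxE mulrC.
by rewrite -[a i j * _]/(a i j *: (u0 j : R^o)) linearZ.
Qed.

End GorensteinDuality.

(** * Free resolutions and complete resolutions *)

Section FreeResolutions.
Variable R : comNzRingType.

Definition free_res (P : cpx R) (N : lmodType R)
    (aug : {linear 'rV[R]_(rk P 0) -> N}) : Prop :=
  [/\ forall x, exists v, aug v = x,
      forall v, aug v = 0 <-> exists w, v = w *m dif P 0 & exact_from 0 P].

(** Bundling a matrix with its sizes lets a resolution be built by iteration. *)
Record sized_mx := SizedMx { nrows : nat; ncols : nat; smx : 'M[R]_(nrows, ncols) }.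

Hypothesis noeR : noetherian R.

Lemma free_res_exists (M : lmodType R) :
  fin_gen M -> exists P aug, @free_res P M aug.
Proof.
case=> n0 [g Hg]; have [aug augE] := row_linear g.
have [Ksub0 KsubD KsubZ] := ker_submod aug.
have [n1 [p0 Hp0]] := submod_fg noeR Ksub0 KsubD KsubZ.
have ker (s : sized_mx) :
    {kc : {k : nat & 'M[R]_(k, nrows s)} | exmx (projT2 kc) (smx s)}.
  by apply: cid; have [k [c Hc]] := ker_fg noeR (smx s); exists (existT _ k c).
pose next s := SizedMx (projT2 (sval (ker s))).
pose s i := iter i next (SizedMx p0).
pose P := @Cpx R (fun i => ncols (s i)) (fun i => smx (s i)).
exists P, aug; split; [|exact: Hp0|by move=> i _; apply: svalP (ker (s i))].
move=> x; have [c ->] := Hg x; exists (\row_i c i).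
by rewrite augE; apply: eq_bigr => i _; rewrite mxE.
Qed.

(** [T] extends the high syzygies of [P] to the right so that the dual of [T]
    is exact; [phi] compares [T] with [P], the index of [T] being shifted by
    one, and is an isomorphism in high degrees. *)
Definition completion (P T : cpx R) (phi : forall i, 'M[R]_(rk T i.+1, rk P i)) :=
  [/\ coexact T, forall i, phi i.+1 *m dif P i = dif T i.+1 *m phi i &
      exists k, forall i, (k <= i)%N ->
        exists psi, phi i *m psi = 1%:M /\ psi *m phi i = 1%:M].

(** The new differential is the transpose of a matrix of generators for the
    kernel of the last transposed differential. *)
Lemma coexact_cons (T : cpx R) : coexact T ->
  exists n (t : 'M_(rk T 0, n)), coexact (ccons t).
Proof.
move=> HT; have [n [c Hc]] := ker_fg noeR (dif T 0)^T.
by exists n, c^T => -[|i] /=; rewrite ?trmxK //; apply: HT.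
Qed.

Lemma completion_base (P : cpx R) : coexact P -> exists T phi, @completion P T phi.
Proof.
move=> HP; have [n [t Ht]] := coexact_cons HP.
exists (ccons t), (fun i => 1%:M); split=> // [i|].
  by rewrite mul1mx mulmx1.
by exists 0%N => i _; exists 1%:M; rewrite mulmx1.
Qed.

(** Exactness of the dual of [T] extends the comparison map one degree down;
    [T] itself is then prolonged by one more term. *)
Lemma completion_step (P : cpx R) : is_cpx P ->
  (exists T phi, @completion (cshift P) T phi) ->
  exists T phi, @completion P T phi.
Proof.
move=> HP [T [phi [HT comm [k iso]]]].
have [X XE] : exists X, (phi 0%N *m dif P 0)^T = X *m (dif T 0)^T.
  apply: (exmx_factor (HT 0%N)); rewrite -trmx_mul mulmxA -comm /=.
  by rewrite -mulmxA HP mulmx0 trmx0.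
have [n [t Ht]] := coexact_cons HT.
exists (ccons t), (fun i => match i return 'M_(rk (ccons t) i.+1, rk P i) with
  | 0 => X^T | j.+1 => phi j end); split=> // [[|i]|] /=.
- by rewrite -[LHS]trmxK XE trmx_mul trmxK.
- exact: comm.
- by exists k.+1 => -[//|i] ki; apply: iso.
Qed.

Hypothesis injR : finite_id (R^o : lmodType R).

(** In high degrees the dual of [P] is exact, and [P] is its own completion
    there; the remaining degrees are added one at a time. *)
Lemma completion_exists (P : cpx R) : exact_from 0 P ->
  exists T phi, @completion P T phi.
Proof.
move=> HP; have [k dual] := exact_dual injR.
have PC : is_cpx P by move=> i; apply/exmx_mul0/HP.
have cos s i : (s <= i)%N -> cosyzygy s (dif P i).
  elim: s i => // s IH [//|i] si; exists (rk P i), (dif P i); split; first exact: HP.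
  exact: IH.
have tail j : (forall i, (j <= i)%N -> exmx (dif P i)^T (dif P i.+1)^T) ->
    exists T phi, @completion P T phi.
  elim: j P PC {HP cos} => [|j IH] P PC Hj.
    by apply: completion_base => i; apply: Hj.
  apply: completion_step => //; apply: IH => [i|i ji]; first exact: PC.
  exact: Hj.
by apply: (tail k) => i ki; apply: dual (cos _ _ ki); apply: HP.
Qed.

(** The transposed complex continues forever, so that all its cokernels are
    arbitrarily high syzygies and dualizing again is exact. *)
Lemma coexact_exact (T : cpx R) : coexact T -> exact_from 0 T.
Proof.
move=> HT; have [k dual] := exact_dual injR.
have cos s i : cosyzygy s (dif T i)^T.
  by elim: s i => // s IH i; exists (rk T i.+2), (dif T i.+1)^T; split.
move=> i _; rewrite -[dif T i]trmxK -[dif T i.+1]trmxK.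
exact: dual (HT i) (cos k i.+1).
Qed.

End FreeResolutions.

Section Cone.
Variables (R : comNzRingType) (P T : cpx R).
Variable phi : forall i, 'M[R]_(rk T i.+1, rk P i).
Hypothesis comm : forall i, phi i.+1 *m dif P i = dif T i.+1 *m phi i.

(** Because of the shift in the index of [T], the term [T i] lies over degree
    [i - 1] of [P], as it must in a mapping cone. *)
Definition cone : cpx R := @Cpx R (fun i => (rk T i + rk P i)%N)
  (fun i => block_mx (- dif T i) (phi i) 0 (dif P i)).

Lemma cone_cpx : is_cpx T -> is_cpx P -> is_cpx cone.
Proof.
move=> HT HP i; rewrite /= mulmx_block !mul0mx !mulmx0 !mulNmx mulmxN HT HP.
by rewrite comm !oppr0 !addr0 addNr -[RHS]block_mx0.
Qed.

Lemma cone_exact : exact_from 0 T -> exact_from 0 P -> exact_from 0 cone.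
Proof.
move=> HT HP i _;
apply: exmxP; first by apply: cone_cpx => j; apply/exmx_mul0; [apply: HT|apply: HP].
move=> v; rewrite -[v]hsubmxK; set t := lsubmx v; set x := rsubmx v => /=.
rewrite mul_row_block mulmxN mulmx0 addr0 => /eqP.
rewrite row_mx_eq0 oppr_eq0 => /andP[/eqP/(HT i isT)[w wE] /eqP tx0].
have /(HP i isT)[y yE] : (x + w *m phi i.+1) *m dif P i = 0.
  by rewrite mulmxDl -mulmxA comm mulmxA -wE addrC.
exists (row_mx (- w) y); rewrite mul_row_block mulmxN mulNmx opprK mulmx0 addr0.
by rewrite -wE -yE mulNmx addrC addrK.
Qed.

Lemma cone_split k : (forall i, (k <= i)%N ->
    exists psi, phi i *m psi = 1%:M /\ psi *m phi i = 1%:M) ->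
  split_from k cone.
Proof.
move=> iso i ki; have [psi [e1 e2]] := iso i ki.
have [psi' [e1' e2']] := iso i.+1 (leqW ki).
exists (block_mx 0 0 psi 0), (block_mx 0 0 psi' 0) => /=.
rewrite !mulmx_block !(mul0mx, mulmx0) add_block_mx !(addr0, add0r) e1 e2'.
have -> : dif P i *m psi = psi' *m dif T i.+1.
  rewrite -[LHS]mul1mx -e2' -!mulmxA [phi i.+1 *m _]mulmxA comm -mulmxA e1.
  by rewrite mulmx1.
by rewrite mulmxN subrr -scalar_mx_block.
Qed.

End Cone.

(** * Finite projective dimension *)

Section ProjectiveDimension.
Variable R : comNzRingType.

Lemma finite_pd_projective (P : lmodType R) : projective P -> finite_pd P.
Proof.
move=> projP; pose Z : lmodType R := 'rV[R]_0.
pose obj i : lmodType R := if i is _.+1 then Z else P.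
pose d i : {linear obj i.+1 -> obj i} := \0.
have Z0 i (x : obj i.+1) : x = 0 by rewrite [x](@thinmx0 R 1).
have pobj i : projective (obj i) by case: i => [|i] //; apply: free_projective.
have surj (x : P) : exists y : obj 0%N, (idfun : {linear obj 0%N -> P}) y = x.
  by exists x.
have ex0 : exact_at (d 0%N) (idfun : {linear obj 0%N -> P}).
  by move=> b; split=> [b0|[a <-]//]; exists 0; rewrite [RHS]b0.
have ex i : exact_at (d i.+1) (d i).
  by move=> b; split=> // _; exists 0; rewrite (Z0 i b).
by exists (ProjResolution pobj surj ex0 ex), 0%N => -[].
Qed.

Lemma finite_pd_extend (K F N : lmodType R) (b : {linear K -> F})
    (a : {linear F -> N}) :
  projective F -> (forall x, exists y, a y = x) -> injective b ->
  exact_at b a -> finite_pd K -> finite_pd N.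
Proof.
move=> projF asurj binj ex [Q [k Q0]].
pose obj i : lmodType R := if i is j.+1 then Q j else F.
pose d i : {linear obj i.+1 -> obj i} :=
  match i return {linear obj i.+1 -> obj i} with
  | 0 => b \o pres_aug Q | j.+1 => pres_d Q j end.
have pobj i : projective (obj i) by case: i => [|i] //; apply: pres_proj.
have ex0 : exact_at (d 0%N) (a : {linear obj 0%N -> N}).
  move=> y; split=> [/ex[x <-]|[x <-]].
    by have [x' <-] := pres_aug_surj Q x; exists x'.
  by apply/ex; exists (pres_aug Q x).
have exi i : exact_at (d i.+1) (d i).
  case: i => [|i]; last exact: pres_exact.
  move=> y; split=> [|H]; last by rewrite /= (@pres_exact0 _ _ Q y).2 ?linear0.
  by rewrite /= -[RHS](linear0 b) => /binj/(@pres_exact0 _ _ Q _).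
exists (ProjResolution pobj asurj ex0 exi), k.+1 => -[//|i] ki.
exact: Q0.
Qed.

Lemma projective_retract (F K : lmodType R) (s : {linear K -> F})
    (r : {linear F -> K}) :
  projective F -> (forall x, r (s x) = x) -> projective K.
Proof.
move=> projF rs A B g h gsurj.
have [f Hf] := projF _ _ g (h \o r) gsurj.
by exists (f \o s) => x; rewrite /= Hf /= rs.
Qed.

Section Resolution.
Variables (P : cpx R) (N : lmodType R) (aug : {linear 'rV[R]_(rk P 0) -> N}).
Hypothesis res : free_res aug.

Let im j := quo (ker_submod (mulmxr (dif P j) : {linear 'rV_(rk P j.+1) -> 'rV_(rk P j)})).

(** The image of a regular matrix is a direct summand of a free module, hence
    projective, and can replace the part of the resolution to its left. *)
Lemma regmx_finite_pd i : regmx (dif P i) -> finite_pd N.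
Proof.
have [augsurj augker ex] := res.
have emb j : exists b : {linear im j -> 'rV[R]_(rk P j)},
    forall v, b (quo_pi _ v) = v *m dif P j.
  exact: (quo_lift _ (f := mulmxr (dif P j))).
have embinj j (b : {linear im j -> 'rV[R]_(rk P j)}) :
    (forall v, b (quo_pi _ v) = v *m dif P j) -> injective b.
  move=> Hb x y; have [v <-] := quo_surj x; have [w <-] := quo_surj y.
  rewrite !Hb => vw; apply/eqP; rewrite -subr_eq0 -linearB; apply/eqP/quo_piP.
  by rewrite linearB /= vw subrr.
have embex j (L : lmodType R) (a : {linear 'rV[R]_(rk P j) -> L})
    (b : {linear im j -> 'rV[R]_(rk P j)}) :
    (forall v, b (quo_pi _ v) = v *m dif P j) ->
    (forall v, a v = 0 <-> exists w, v = w *m dif P j) -> exact_at b a.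
  move=> Hb Ha v; rewrite Ha; split=> [[w ->]|[x <-]].
    by exists (quo_pi _ w); rewrite Hb.
  by have [w <-] := quo_surj x; exists w; rewrite Hb.
move=> [h hE].
have : finite_pd (im i : lmodType R).
  apply: finite_pd_projective.
  have [|s Hs] := @quo_lift _ _ _ (ker_submod (mulmxr (dif P i)))
      _ (mulmxr (dif P i *m h) : {linear 'rV_(rk P i.+1) -> 'rV_(rk P i.+1)}).
    by move=> v /= vd0; rewrite mulmxA vd0 mul0mx.
  apply: (@projective_retract _ _ s (quo_pi _) (@free_projective R (rk P i.+1))).
  move=> x; have [v <-] := quo_surj x; rewrite Hs; apply/eqP.
  rewrite -subr_eq0 -linearB; apply/eqP/quo_piP.
  by rewrite linearB /= -mulmxA hE subrr.
elim: i {h hE} => [|i IH] pd.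
  have [b Hb] := emb 0%N.
  exact: (finite_pd_extend (@free_projective R _) augsurj (embinj _ _ Hb)
    (embex _ _ _ _ Hb augker) pd).
have [b Hb] := emb i.+1; apply: IH.
apply: (finite_pd_extend (a := quo_pi _) (@free_projective R _) _
  (embinj _ _ Hb) _ pd); first exact: quo_surj.
apply: embex => // v; rewrite quo_piP /=; exact: ex.
Qed.

(** Comparing the free resolution with a bounded projective one, the identity
    becomes null-homotopic in high degrees.  Only one degree at a time is
    needed: [alpha] and [beta] are the comparison maps and [G] is the part of
    the homotopy that factors through the differential. *)
Lemma finite_pd_regmx : finite_pd N ->
  exists k, forall i, (k <= i)%N -> regmx (dif P i).
Proof.
have [augsurj augker ex] := res.
case=> Q [k Q0]; exists k => i ki.
pose zP i (v : 'rV_(rk P i)) := exists w, v = w *m dif P i.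
pose zQ i (x : Q i) := exists y, pres_d Q i y = x.
have zP_S j (v : 'rV_(rk P j.+1)) : v *m dif P j = 0 <-> zP j.+1 v by exact: ex.
have zQ_S j (x : Q j.+1) : pres_d Q j x = 0 <-> zQ j.+1 x by exact: pres_exact.
have zP_sub j v w : zP j v -> zP j w -> zP j (v - w).
  by move=> [x ->] [y ->]; exists (x - y); rewrite mulmxBl.
pose comparison j := exists (alpha : {linear 'rV_(rk P j) -> Q j})
    (beta : {linear Q j -> 'rV_(rk P j)})
    (G : {linear 'rV_(rk P j) -> 'rV_(rk P j)}),
  [/\ forall v, zP j v -> zQ j (alpha v), forall x, zQ j x -> zP j (beta x),
      forall v, zP j v -> G v = 0 &
      forall v, zP j (v - beta (alpha v) - G v)].
have lift_alpha j (alpha : {linear 'rV_(rk P j) -> Q j}) :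
    (forall v, zP j v -> zQ j (alpha v)) ->
    exists alpha' : {linear 'rV_(rk P j.+1) -> Q j.+1},
      forall v, pres_d Q j (alpha' v) = alpha (v *m dif P j).
  move=> Ha; apply: (projective_lift (f := alpha \o mulmxr (dif P j))).
    exact: free_projective.
  by move=> v; apply: Ha; exists v.
have lift_G j (G : {linear 'rV_(rk P j) -> 'rV_(rk P j)}) :
    (forall v, zP j (G v)) ->
    exists g : {linear 'rV_(rk P j) -> 'rV_(rk P j.+1)},
      forall v, g v *m dif P j = G v.
  move=> HG; apply: (projective_lift (g := mulmxr (dif P j))).
    exact: free_projective.
  by move=> v; have [w ->] := HG v; exists w.
have comp j : comparison j.
  elim: j => [|j [alpha [beta [G [Ha Hb HG HE]]]]].
    have [|alpha Ha] := projective_lift (f := aug) (g := pres_aug Q)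
      (@free_projective R _); first by move=> v; apply: pres_aug_surj.
    have [|beta Hb] := projective_lift (f := pres_aug Q) (g := aug)
      (@pres_proj _ _ Q 0%N); first by move=> x; apply: augsurj.
    exists alpha, beta, \0; split=> // [v /augker v0|x /(@pres_exact0 _ _ Q _) x0|v].
    - by apply/(@pres_exact0 _ _ Q _); rewrite Ha.
    - by apply/augker; rewrite Hb.
    - by apply/augker; rewrite subr0 linearB Hb Ha subrr.
  have [alpha' Ha'] := lift_alpha j alpha Ha.
  have [|beta' Hb'] := projective_lift (f := beta \o pres_d Q j)
    (g := mulmxr (dif P j)) (@pres_proj _ _ Q j.+1).
    by move=> x /=; have [|w ->] := Hb (pres_d Q j x); [exists x|exists w].
  have [g Hg] := lift_G j (idfun \- (beta \o alpha) \- G) HE.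
  exists alpha', beta', (g \o mulmxr (dif P j)); split=> [v|x|v|v].
  - by move=> /zP_S v0; apply/zQ_S; rewrite Ha' v0 linear0.
  - by move=> /zQ_S x0; apply/zP_S; have /= -> := Hb' x; rewrite x0 linear0.
  - by move=> /zP_S v0; rewrite /= v0 linear0.
  - apply/zP_S; rewrite !mulmxBl /= Hg /=.
    have /= -> := Hb' (alpha' v); rewrite Ha'.
    by rewrite (HG (v *m _)) ?subr0 ?subrr //; exists v.
have [alpha [beta [G [Ha Hb HG HE]]]] := comp i.
(* [Q] vanishes in degree [i.+1], so [alpha] kills the cycles of degree [i];
   on them [g] is therefore a section of the differential. *)
have [g Hg] := lift_G i (idfun \- (beta \o alpha) \- G) HE.
have [h hE] := row_linear_mx g; exists h.
apply/row_matrixP => j; rewrite !row_mul -hE Hg /=.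
have zj : zP i (row j (dif P i)) by exists (delta_mx 0 j); rewrite rowE.
rewrite HG // subr0.
have [alpha' Ha'] := lift_alpha i alpha Ha.
have -> : alpha (row j (dif P i)) = 0 by rewrite rowE -Ha' (Q0 i.+1 _ (alpha' _)) ?linear0.
by rewrite linear0 subr0.
Qed.

End Resolution.

End ProjectiveDimension.

(** * Base change of free modules and of cokernels *)

Section BaseChangeFree.
Variables (R S : comNzRingType) (f : {rmorphism R -> S}).

Let S' : lmodType R := restr f S^o.

Lemma restr_scaleE (N : lmodType S) a (x : restr f N) :
  a *: x = (f a *: (x : N)) :> N.
Proof. by []. Qed.

Section Row.
Variable n : nat.
Let L : lmodType R := restr f ('rV[S]_n : lmodType S).

Definition row_eval (v : 'rV[R]_n) (x : S') : L := (x : S) *: map_mx f v.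

Lemma row_eval_bilinear : bilinear_for *:%R *:%R row_eval.
Proof.
split=> [x a v w|v a x y]; apply/rowP => i.
  rewrite /row_eval /= !mxE rmorphD rmorphM /=; ring.
rewrite /row_eval /= !mxE /GRing.scale /= /restr_scale /GRing.scale /=; ring.
Qed.
HB.instance Definition _ :=
  @bilinear_isBilinear.Build R 'rV[R]_n S' L *:%R *:%R row_eval row_eval_bilinear.

Definition row_of_tens : {linear tens 'rV[R]_n S' -> L} := tens_lift row_eval.

Lemma row_of_tens_mk v (x : S) :
  row_of_tens (tens_mk v (x : S')) = x *: map_mx f v :> 'rV[S]_n.
Proof. exact: (@tens_liftE R 'rV[R]_n S' L row_eval v x). Qed.

Definition tens_of_row (W : 'rV[S]_n) : tens 'rV[R]_n S' :=
  \sum_j tens_mk (delta_mx 0 j) (W 0 j : S').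

Lemma tens_of_rowB : zmod_morphism tens_of_row.
Proof.
move=> V W; rewrite /tens_of_row -sumrB; apply: eq_bigr => j _.
by rewrite !mxE; exact: linearBr.
Qed.

Lemma row_of_tensK : cancel row_of_tens tens_of_row.
Proof.
apply: tens_ext => [t u|//|v x]; first by rewrite linearB tens_of_rowB.
rewrite /tens_of_row [in RHS](row_sum_delta v) linear_sumlz row_of_tens_mk.
apply: eq_bigr => j _; rewrite !mxE linearZl_LR.
rewrite -[RHS]linearZr_LR; congr tens_mk; exact: mulrC.
Qed.

Lemma tens_of_rowK : cancel tens_of_row row_of_tens.
Proof.
move=> W; rewrite /tens_of_row linear_sum; apply/rowP => i.
rewrite [RHS](congr1 (fun v : 'rV_n => v 0 i) (row_sum_delta W)).
rewrite !summxE; apply: eq_bigr => j _; rewrite row_of_tens_mk.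
by rewrite !mxE rmorph_nat.
Qed.

End Row.
Arguments row_of_tens {n}.

Lemma row_of_tens_map n m (a : 'M[R]_(n, m)) (t : tens 'rV[R]_n S') :
  row_of_tens (tens_map (mulmxr a : {linear 'rV_n -> 'rV_m}) (idfun : {linear S' -> S'}) t)
  = (row_of_tens t : 'rV[S]_n) *m map_mx f a :> 'rV[S]_m.
Proof.
move: t; apply: tens_ext => [t u|t u|v x]; first by rewrite !linearB.
  by rewrite linearB mulmxBl.
rewrite tens_mapE !row_of_tens_mk /=.
by rewrite map_mxM scalemxAl.
Qed.

(** Right exactness of base change.  For the direct implication, sending an
    element of [M] to the class of [map_mx f v], for any [v] above it, is well
    defined and semilinear, and this defines a map from the tensor product to the
    cokernel of the base changed matrix. *)
Lemma base_change_relations (P : cpx R) (M : lmodType R)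
    (aug : {linear 'rV[R]_(rk P 0) -> M}) (W : 'rV[S]_(rk P 0)) :
  free_res aug ->
  (\sum_j tens_mk (aug (delta_mx 0 j)) (W 0 j : S') = 0 :> base_change f M) <->
  exists Y, W = Y *m map_mx f (dif P 0).
Proof.
case=> surj ker _.
pose ft : {linear tens 'rV[R]_(rk P 0) S' -> tens M S'} :=
  tens_map aug (idfun : {linear S' -> S'}).
have ftE V : ft (tens_of_row V) = \sum_j tens_mk (aug (delta_mx 0 j)) (V 0 j : S').
  by rewrite /tens_of_row linear_sum; apply: eq_bigr => j _; rewrite [LHS]tens_mapE.
rewrite -[X in X = 0]ftE; split=> [W0|[Y WY]]; last first.
  have -> : W = row_of_tens (tens_map (mulmxr (dif P 0) : {linear 'rV_(rk P 1) -> 'rV_(rk P 0)})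
      (idfun : {linear S' -> S'}) (tens_of_row Y)).
    by rewrite row_of_tens_map tens_of_rowK.
  rewrite row_of_tensK; move: (tens_of_row Y).
  apply: tens_ext => [t u|t u|v x]; first by rewrite !linearB.
    by rewrite subr0.
  rewrite tens_mapE [LHS]tens_mapE /=.
  have -> : aug (v *m dif P 0) = 0 by apply/ker; exists v.
  by rewrite linear0l.
have [s Hs] := choice surj.
pose K := im_submod (mulmxr (map_mx f (dif P 0)) :
  {linear 'rV_(rk P 1) -> 'rV_(rk P 0)}).
pose D m := quo_pi K (map_mx f (s m)).
have Daug v : D (aug v) = quo_pi K (map_mx f v).
  apply/eqP; rewrite -subr_eq0 -linearB -map_mxB; apply/eqP/quo_piP.
  have /ker[w ->] : aug (s (aug v) - v) = 0 by rewrite linearB Hs subrr.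
  by exists (map_mx f w); rewrite map_mxM.
have Dlin a m m' : D (a *: m + m') = f a *: D m + D m'.
  rewrite -(Hs m) -(Hs m') -linearP !Daug -linearP; congr (quo_pi K _).
  by apply/rowP => i; rewrite !mxE rmorphD rmorphM.
pose L : lmodType R := restr f (quo K).
pose b (m : M) (x : S') : L := (x : S) *: (D m : quo K).
have bbil : bilinear_for *:%R *:%R b.
  split=> [x a m m'|m a x y].
    rewrite /b /= Dlin scalerDr; congr (_ + _).
    by rewrite [RHS]restr_scaleE !scalerA mulrC.
  rewrite /b /= scalerDl; congr (_ + _).
  by rewrite [RHS]restr_scaleE scalerA.
pose bb : {bilinear M -> S' -> L} :=
  HB.pack b (@bilinear_isBilinear.Build R M S' L *:%R *:%R b bbil).
have : tens_lift bb (ft (tens_of_row W)) = 0 by rewrite W0 linear0.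
rewrite ftE linear_sum.
have -> : \sum_j tens_lift bb (tens_mk (aug (delta_mx 0 j)) (W 0 j : S'))
    = quo_pi K W :> quo K.
  rewrite [in RHS](row_sum_delta W) linear_sum; apply: eq_bigr => j _.
  rewrite tens_liftE -[LHS]/((W 0 j) *: D (aug (delta_mx 0 j))) Daug linearZ.
  congr (_ *: quo_pi K _).
  by apply/rowP => i; rewrite !mxE rmorph_nat.
by move/quo_piP.
Qed.

Definition coker (P : cpx R) : lmodType R :=
  quo (im_submod (mulmxr (dif P 0) : {linear 'rV_(rk P 1) -> 'rV_(rk P 0)})).

Lemma coker_res (P : cpx R) : exact_from 0 P ->
  @free_res R P (coker P) (quo_pi _).
Proof.
by move=> ex; split=> // [x|v]; [apply: quo_surj|apply: quo_piP].
Qed.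

Lemma coker_fg (P : cpx R) : fin_gen (coker P).
Proof.
exists (rk P 0), (fun i => quo_pi _ (delta_mx 0 i)) => x.
have [v <-] := quo_surj x; exists (v 0).
rewrite [in LHS](row_sum_delta v) linear_sum; apply: eq_bigr => j _.
by rewrite linearZ.
Qed.

Lemma Tor1_coker (P : cpx R) : exact_from 0 P ->
  exmx (map_mx f (dif P 1)) (map_mx f (dif P 0)) ->
  Tor_zero 1 (coker P) S'.
Proof.
move=> ex exf; have [surj ker _] := coker_res ex.
pose obj i : lmodType R := 'rV[R]_(rk P i).
pose d i : {linear obj i.+1 -> obj i} := mulmxr (dif P i).
have pobj i : projective (obj i) by apply: free_projective.
have ex0 : exact_at (d 0%N) (quo_pi _ : {linear obj 0%N -> coker P}).
  by move=> v; rewrite ker; split=> [[w ->]|[w <-]]; exists w.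
have exi i : exact_at (d i.+1) (d i).
  move=> v; split=> [/(ex i isT)[w ->]|[w <-]]; first by exists w.
  by apply/(ex i isT); exists w.
exists (ProjResolution pobj surj ex0 exi).
pose d0 := tens_map (d 0%N) (idfun : {linear S' -> S'}).
pose d1 := tens_map (d 1%N) (idfun : {linear S' -> S'}).
rewrite -[tens_homology_zero _ _ _]/(exact_at d1 d0) => t.
have d0E u : row_of_tens (d0 u) = (row_of_tens u : 'rV[S]_(rk P 1)) *m map_mx f (dif P 0)
  :> 'rV[S]_(rk P 0) by exact: row_of_tens_map.
have d1E u : row_of_tens (d1 u) = (row_of_tens u : 'rV[S]_(rk P 2)) *m map_mx f (dif P 1)
  :> 'rV[S]_(rk P 1) by exact: row_of_tens_map.
split=> [t0|[u <-]].
  have /exf[W WE] : (row_of_tens t : 'rV[S]_(rk P 1)) *m map_mx f (dif P 0) = 0.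
    by rewrite -d0E t0 linear0.
  exists (tens_of_row W); apply: (can_inj (@row_of_tensK _)).
  by rewrite d1E tens_of_rowK WE.
apply: (can_inj (@row_of_tensK _)); rewrite d0E d1E linear0.
by apply/exf; exists (row_of_tens u).
Qed.

End BaseChangeFree.

(** * Invariance of strong rigidity *)

Section TorIso.
Variables (R : comNzRingType) (N N' : lmodType R) (g : {linear N -> N'}).
Hypotheses (ginj : injective g) (gsurj : forall y, exists x, g x = y).

(** Tensoring with [g] and its inverse identifies the two complexes. *)
Lemma Tor_zero_iso i M : Tor_zero i.+1 M N' -> Tor_zero i.+1 M N.
Proof.
have [g' g'K] := choice gsurj.
have g'lin : linear g'.
  by move=> a x y; apply: ginj; rewrite linearP !g'K.
case=> P HP; exists P; move: HP; rewrite /tens_homology_zero.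
cbv zeta => HP t.
pose G (L : lmodType R) : {linear tens L N -> tens L N'} :=
  tens_map (idfun : {linear L -> L}) g.
pose G' (L : lmodType R) : {linear tens L N' -> tens L N} :=
  tens_map (idfun : {linear L -> L}) (lin_of g'lin).
have GK L : cancel (G L) (G' L).
  apply: tens_ext => [x y|//|m x]; first by rewrite !linearB.
  rewrite [G L _]tens_mapE [LHS]tens_mapE /=; congr tens_mk.
  by apply: ginj; rewrite g'K.
have G'K L : cancel (G' L) (G L).
  apply: tens_ext => [x y|//|m x]; first by rewrite !linearB.
  by rewrite [G' L _]tens_mapE [LHS]tens_mapE /= g'K.
have Gd (L L' : lmodType R) (h : {linear L -> L'}) u :
    G L' (tens_map h (idfun : {linear N -> N}) u)
    = tens_map h (idfun : {linear N' -> N'}) (G L u).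
  move: u; apply: tens_ext => [x y|x y|m x]; rewrite ?linearB //.
  by rewrite tens_mapE [G L _]tens_mapE [LHS]tens_mapE [RHS]tens_mapE.
split=> [t0|[u <-]].
  have /HP[u Hu] : tens_map (pres_d P i) (idfun : {linear N' -> N'}) (G _ t) = 0.
    by rewrite -Gd t0 linear0.
  by exists (G' _ u); apply: (can_inj (GK _)); rewrite Gd G'K.
by apply: (can_inj (GK _)); rewrite !Gd linear0; apply/HP; exists (G _ u).
Qed.

End TorIso.

Section LocalizedFrobenius.
Variables (R : comNzRingType) (p : nat) (hp : p \in [pchar R]) (n : nat).
Variable q : prime_idealr R.

Let N : lmodType R := frob_module hp n.
Let A : comNzRingType := loc_ring q.
Let N' : lmodType A := frob_module (loc_pchar q hp) n.
Let e := (p ^ n)%N.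

Lemma denomX_subproof (s : denom q) k : dval s ^+ k \notin q.
Proof.
elim: k => [|k IH]; first by rewrite expr0 idealr1.
by rewrite exprS prime_idealrM negb_or dvalP.
Qed.
Definition denomX (s : denom q) k : denom q :=
  exist (fun u => is_true (u \notin q)) _ (denomX_subproof s k).

Lemma dvalX s k : dval (denomX s k) = dval s ^+ k. Proof. by []. Qed.

(** The map [m / s |-> m / s ^ (p ^ n)]: a denominator [s] acts on the Frobenius
    module as [s ^ (p ^ n)]. *)
Definition loc_frob (x : loc q N) : N' :=
  loc_frac ((repr x).1 : R) (denomX (repr x).2 e).

Lemma loc_frobE (m : N) (s : denom q) :
  loc_frob (loc_mk m s) = loc_frac (m : R) (denomX s e).
Proof.
have [u uE] := loc_reprE m s; apply/loc_frac_eq; exists (denomX u e).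
by rewrite !dvalX -!exprMn; exact: uE.
Qed.

Lemma loc_fracX (a : R) (s : denom q) k :
  loc_frac a s ^+ k = loc_frac (a ^+ k) (denomX s k).
Proof.
elim: k => [|k IH]; first by apply: loc_frac_eq1; rewrite ?dvalX ?dvalE !expr0.
rewrite exprS IH [LHS]loc_mulE.
by apply: loc_frac_eq1; rewrite !(dvalX, dvalE) !exprS mulrC.
Qed.

Lemma loc_frob_linear : linear loc_frob.
Proof.
have scN (r m : R) : (r *: (m : N)) = r ^+ e * m :> R by [].
have scN' (x y : A) : (x *: (y : N')) = x ^+ e * y :> A by [].
move=> x y z; case: (loc_ringP x) => a s; case: (locP y) => m t.
case: (locP z) => m' t'.
rewrite [_ *: _]loc_scaleE loc_mkD !loc_frobE scN' loc_fracX.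
rewrite [_ * _]loc_mulE [RHS]loc_fracD; apply: loc_frac_eq1.
rewrite !(dvalX, dvalE); congr (_ * _); first by rewrite -!exprMn.
rewrite -[LHS]/(dval t' ^+ e * (a ^+ e * m) + (dval s * dval t) ^+ e * m').
by rewrite exprMn.
Qed.

Lemma loc_frob_inj : injective loc_frob.
Proof.
move=> x y; case: (locP x) => m s; case: (locP y) => m' t.
rewrite !loc_frobE => /loc_frac_eq[u]; rewrite !dvalX => uE.
apply/loc_mk_eq; exists u.
rewrite -[LHS]/((dval u * dval t) ^+ e * m) -[RHS]/((dval u * dval s) ^+ e * m').
have [k eE] : exists k, e = k.+1.
  by exists e.-1; rewrite prednK // expn_gt0 prime_gt0 //; case/andP: hp.
have ue : dval u ^+ e = dval u ^+ k * dval u by rewrite eE exprSr.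
by rewrite !exprMn ue -!mulrA; congr (_ * _); rewrite !mulrA.
Qed.

Lemma loc_frob_surj (y : N') : exists x, loc_frob x = y.
Proof.
case: (@loc_ringP _ q y) => a s.
have [k eE] : exists k, e = k.+1.
  by exists e.-1; rewrite prednK // expn_gt0 prime_gt0 //; case/andP: hp.
exists (loc_mk (a * dval s ^+ k : N) s); rewrite loc_frobE.
by apply: loc_frac_eq1; rewrite dvalX eE exprS mulrCA mulrC.
Qed.

Lemma strongly_rigid_loc : strongly_rigid (loc q N : lmodType (loc_ring q)) ->
  strongly_rigid N'.
Proof.
move=> H [//|i] M _ fgM /(Tor_zero_iso (g := lin_of loc_frob_linear)) T.
by apply: (H i.+1) => //; apply: T; [apply: loc_frob_inj|apply: loc_frob_surj].
Qed.

End LocalizedFrobenius.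

(** * Localized resolutions *)

Lemma regmx_conj (R : comNzRingType) n m n' m' (a : 'M[R]_(n, m))
    (U : 'M_(n', n)) (U' : 'M_(n, n')) (V : 'M_(m, m')) (V' : 'M_(m', m)) :
  U' *m U = 1%:M -> V *m V' = 1%:M -> regmx a -> regmx (U *m a *m V).
Proof.
move=> UU VV [h e]; exists (V' *m h *m U').
rewrite !mulmxA -[_ *m V *m V']mulmxA VV mulmx1 -[_ *m U' *m U]mulmxA UU mulmx1.
by rewrite -[U *m a *m h]mulmxA -[U *m (a *m h) *m a]mulmxA e.
Qed.

Section Localized.
Variables (R : comNzRingType) (q : prime_idealr R).
Let A : comNzRingType := loc_ring q.

Lemma free_res_loc (P : cpx R) (M : lmodType R)
    (aug : {linear 'rV[R]_(rk P 0) -> M}) :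
  free_res aug -> exists augq, @free_res A (cmap (locm q) P) (loc q M) augq.
Proof.
case=> surj ker ex.
pose one := denom1 q.
have mkD x y : loc_mk (x + y) one = loc_mk x one + loc_mk y one :> loc q M.
  by rewrite loc_mkD; apply: loc_mk_eq1; rewrite !dvalE mulr1 !scale1r.
have mkZ a (x : M) : loc_mk (a *: x) one = locm q a *: loc_mk x one :> loc q M.
  by rewrite [RHS]loc_scaleE; apply: loc_mk_eq1; rewrite !dvalE mulr1.
have [augq augqE] := @row_linear A _ (loc q M)
  (fun i => loc_mk (aug (delta_mx 0 i)) one).
have augq_loc v : augq (map_mx (locm q) v) = loc_mk (aug v) one.
  rewrite augqE [in RHS](row_sum_delta v) linear_sum.
  under eq_bigr do rewrite mxE -mkZ -linearZ.
  symmetry; apply: (big_morph (fun x => loc_mk x one) mkD) => //.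
exists augq; split=> [x|V|i _]; last by apply/exmx_loc/ex.
  case: (locP x) => m s; have [v <-] := surj m.
  exists (loc_frac 1 s *: map_mx (locm q) v); rewrite linearZ /= augq_loc.
  rewrite [LHS]loc_scaleE; apply: loc_mk_eq1.
  by rewrite !dvalE scale1r mulr1.
have [s sq [v vE]] := locm_mx_num V; have [y y1] := locm_inv sq.
have VE : V = y *: map_mx (locm q) v by rewrite -vE scalerA y1 scale1r.
split=> [V0|[W ->]].
  have : loc_mk (aug v) one = 0 :> loc q M by rewrite -augq_loc -vE linearZ /= V0 scaler0.
  move=> /loc_mk_eq[u]; rewrite !dvalE mulr1 scaler0 -linearZ => /ker[w wE].
  have [z z1] := locm_inv (dvalP u).
  exists ((y * z) *: map_mx (locm q) w).
  rewrite -scalemxAl -map_mxM -wE map_mxZ_locm scalerA -mulrA z1 mulr1.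
  exact: VE.
have [t tq [w wE]] := locm_mx_num W; have [z z1] := locm_inv tq.
have -> : W = z *: map_mx (locm q) w by rewrite -wE scalerA z1 scale1r.
rewrite -scalemxAl linearZ /= -map_mxM augq_loc.
have -> : aug (w *m dif P 0) = 0 by apply/ker; exists w.
exact: scaler0.
Qed.

Variables (P T : cpx R) (phi : forall i, 'M[R]_(rk T i.+1, rk P i)).
Hypothesis Tcompl : completion phi.
Hypothesis exT : exact_from 0 T.

(** Regularity spreads to the right because the dual of [T] is exact. *)
Lemma reg_loc_down i : regmx (map_mx (locm q) (dif T i)) ->
  regmx (map_mx (locm q) (dif T 0)).
Proof.
have [HT _ _] := Tcompl.
elim: i => [//|i IH] H; apply: IH.
have := exmx_loc (q := q) (HT i); rewrite -!map_trmx => /exmx_reg reg.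
by have /regmx_tr := reg (regmx_tr H); rewrite trmxK.
Qed.

Variables (M : lmodType R) (aug : {linear 'rV[R]_(rk P 0) -> M}).
Hypothesis res : free_res aug.

(** [P] and [T] are isomorphic in high degrees, so that the far differentials of
    [P] are regular exactly when those of [T] are. *)
Lemma finite_pd_loc_reg : finite_pd (loc q M : lmodType A) ->
  regmx (map_mx (locm q) (dif T 0)).
Proof.
have [_ comm [k iso]] := Tcompl.
have [augq resq] := free_res_loc res => /(finite_pd_regmx resq)[k' Hk'].
pose i := maxn k k'; have [psi [e1 e2]] := iso i (leq_maxl _ _).
have [psi' [e1' e2']] := iso i.+1 (leqW (leq_maxl _ _)).
apply: (@reg_loc_down i.+1).
have -> : dif T i.+1 = phi i.+1 *m dif P i *m psi.
  by rewrite comm -mulmxA e1 mulmx1.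
rewrite !map_mxM; apply: (regmx_conj (U' := map_mx (locm q) psi')
  (V' := map_mx (locm q) (phi i))).
- by rewrite -map_mxM e2' map_mx1.
- by rewrite -map_mxM e2 map_mx1.
- by apply: Hk'; apply: leq_maxr.
Qed.

Lemma reg_finite_pd_loc k' :
  (forall i, (k' <= i)%N -> regmx (map_mx (locm q) (dif T i))) ->
  finite_pd (loc q M : lmodType A).
Proof.
move=> Hk'; have [_ comm [k iso]] := Tcompl.
have [augq resq] := free_res_loc res.
pose i := maxn k k'; have [psi [e1 e2]] := iso i (leq_maxl _ _).
have [psi' [e1' e2']] := iso i.+1 (leqW (leq_maxl _ _)).
apply: (regmx_finite_pd resq (i := i)) => /=.
have -> : dif P i = psi' *m dif T i.+1 *m phi i.
  by rewrite -mulmxA -comm mulmxA e2' mul1mx.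
rewrite !map_mxM; apply: (regmx_conj (U' := map_mx (locm q) (phi i.+1))
  (V' := map_mx (locm q) psi)).
- by rewrite -map_mxM e1' map_mx1.
- by rewrite -map_mxM e1 map_mx1.
- by apply/Hk'/leqW/leq_maxr.
Qed.

End Localized.

(** * The associated prime *)

Section Main.
Variables (R : comNzRingType) (p : nat) (hp : p \in [pchar R]) (n : nat).
Variables (M : lmodType R) (P T : cpx R).
Variables (phi : forall i, 'M[R]_(rk T i.+1, rk P i)).
Variable aug : {linear 'rV[R]_(rk P 0) -> M}.
Hypotheses (noeR : noetherian R) (res : free_res aug).
Hypotheses (Tcompl : completion phi) (exT : exact_from 0 T).

Let f : {rmorphism R -> R} := frob n hp.

Let cyc (v : 'rV[R]_(rk T 1)) := v *m map_mx f (dif T 0) = 0.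
Let bnd (v : 'rV[R]_(rk T 1)) := exists w, v = w *m map_mx f (dif T 1).

Let bndZ a v : bnd v -> bnd (a *: v).
Proof. by case=> w ->; exists (a *: w); rewrite scalemxAl. Qed.

Let bndD v w : bnd v -> bnd w -> bnd (v + w).
Proof. by case=> x -> [y ->]; exists (x + y); rewrite mulmxDl. Qed.

(** If all classes died in the localization at [q], Tor_1 of the cokernel of the
    localized [T] would vanish.  Strong rigidity would then make the
    differentials of [T], hence those of [P], regular in high degrees. *)
Lemma cycle_rigid (q : prime_idealr R) :
  strongly_rigid (frob_module (loc_pchar q hp) n) -> IPD M q ->
  exists2 v, cyc v & forall s, s \notin q -> ~ bnd (s *: v).
Proof.
move=> rigid ipd; apply: contrapT => noV; apply: ipd.
have exTq : exact_from 0 (cmap (locm q) T) by move=> i _; apply/exmx_loc/exT.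
have tor : Tor_zero 1 (coker (cmap (locm q) T)) (frob_module (loc_pchar q hp) n).
  apply: Tor1_coker => //=; rewrite !frob_loc; apply: exmxP.
    by rewrite -!map_mxM (exmx_mul0 (exT (leqnn 0))) !map_mx0.
  move=> V V0; have [s sq [v vE]] := locm_mx_num V; have [y y1] := locm_inv sq.
  have /locm_mx_eq0[t tq] : map_mx (locm q) (v *m map_mx f (dif T 0)) = 0.
    by rewrite map_mxM -vE -scalemxAl V0 scaler0.
  rewrite scalemxAl => tv0.
  have [u uq [w wE]] : exists2 u, u \notin q & bnd (u *: (t *: v)).
    apply: contrapT => nu; apply: noV; exists (t *: v) => // s' s'q bs'.
    by apply: nu; exists s'.
  have [z z1] : exists z, z * locm q (u * t) = 1.
    by apply: locm_inv; rewrite prime_idealrM negb_or uq.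
  exists ((y * z) *: map_mx (locm q) w); rewrite -scalemxAl -map_mxM -wE scalerA.
  by rewrite map_mxZ_locm scalerA -mulrA z1 mulr1 -vE scalerA y1 scale1r.
have /(finite_pd_regmx (coker_res exTq))[k Hk] := rigid 1%N _ isT (coker_fg _) tor.
exact: (reg_finite_pd_loc Tcompl res Hk).
Qed.

(** Where [M] has finite projective dimension [T] splits, and the Frobenius
    preserves the splitting. *)
Lemma cycle_split (q : prime_idealr R) v :
  ~ IPD M q -> cyc v -> exists2 s, s \notin q & bnd (s *: v).
Proof.
move=> /contrapT/(finite_pd_loc_reg Tcompl res) reg0 cv.
have ex0 := exmx_loc (q := q) (exT (leqnn 0)).
have := map_splitmx (frob n (loc_pchar q hp)) (exmx_reg_split ex0 reg0).
rewrite !frob_loc => sp.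
have comp0 : map_mx (locm q) (map_mx f (dif T 1)) *m
    map_mx (locm q) (map_mx f (dif T 0)) = 0.
  by rewrite -!map_mxM (exmx_mul0 (exT (leqnn 0))) !map_mx0.
have [|W WE] := (split_exmx comp0 sp (map_mx (locm q) v)).1.
  by rewrite -map_mxM cv map_mx0.
have [s sq [w wE]] := locm_mx_num W.
have /locm_mx_eq0[t tq] : map_mx (locm q) (s *: v - w *m map_mx f (dif T 1)) = 0.
  by rewrite map_mxB map_mxZ_locm map_mxM WE -wE scalemxAl subrr.
rewrite scalerBr scalerA scalemxAl => /eqP; rewrite subr_eq0 => /eqP e.
exists (t * s); first by rewrite prime_idealrM negb_or tq.
by exists (t *: w).
Qed.

(** Among the cycles that survive in the localization at [q], one with maximal
    local annihilator has a prime annihilator contained in [q]; there the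
    homology does not vanish, so minimality of [q] makes it equal to [q]. *)
Lemma cycle_annihilator (q : prime_idealr R) :
  strongly_rigid (frob_module (loc_pchar q hp) n) -> minimal_in (IPD M) q ->
  exists2 v, cyc v & forall a, a \in q <-> bnd (a *: v).
Proof.
move=> rigid [ipd qmin]; have [v0 cyc0 surv0] := cycle_rigid rigid ipd.
pose I v a := exists2 s, s \notin q & bnd ((s * a) *: v).
have Iid v : is_ideal (I v).
  split=> [|x y [s sq sx] [t tq ty]|a x [s sq sx]].
  - exists 1; first by rewrite idealr1.
    by exists 0; rewrite mulr0 scale0r mul0mx.
  - exists (s * t); first by rewrite prime_idealrM negb_or sq.
    have -> : (s * t * (x + y)) *: v = t *: ((s * x) *: v) + s *: ((t * y) *: v).
      by rewrite !scalerA -scalerDl; congr (_ *: _); ring.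
    by apply: bndD; apply: bndZ.
  - exists s => //; rewrite mulrCA -scalerA; exact: bndZ.
have [||_ [v [cv [nI1 ->]]] vmax] := @noeth_max R noeR
  (fun J => exists v, cyc v /\ ~ I v 1 /\ J = I v).
- by move=> _ [v [_ [_ ->]]]; apply: Iid.
- exists (I v0), v0; split=> //; split=> // -[s sq].
  by rewrite mulr1 => /(surv0 s sq).
have Iq a : I v a -> a \in q.
  case=> s sq bsa; apply: contrapT => /negP aq; apply: nI1; exists (s * a).
    by rewrite prime_idealrM negb_or sq.
  by rewrite mulr1.
have Iprime a b : I v (a * b) -> I v a \/ I v b.
  move=> [s sq sab]; have [|nIb] := pselect (I v b); [by right|left].
  apply: (vmax (I (b *: v))).
  - exists (b *: v); split; first by rewrite /cyc -scalemxAl cv scaler0.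
    split=> // -[t tq]; rewrite mulr1 scalerA => tb.
    by apply: nIb; exists t.
  - move=> c [t tq tc]; exists t => //.
    by rewrite scalerA mulrC -scalerA; apply: bndZ.
  - by exists s => //; rewrite scalerA -mulrA.
pose Q : {pred R} := [pred a | `[< I v a >]].
have Qcl : idealr_closed Q.
  split; rewrite ?inE.
  - exact/asboolP/(id0 (Iid v)).
  - exact/asboolP.
  - move=> a x y /asboolP Ix /asboolP Iy; apply/asboolP.
    by apply: (idD (Iid v)) => //; apply: (idM (Iid v)).
have Qpr : prime_idealr_closed Q.
  move=> a b /asboolP/Iprime[] H; apply/orP; [left|right]; exact/asboolP.
pose q' : prime_idealr R := HB.pack (Q : R -> bool) (isIdealr.Build R Q Qcl)
  (isPrimeIdealrClosed.Build R Q Qpr).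
have qI a : a \in q -> I v a.
  suff sub : {subset q <= q'} by move=> /sub/asboolP.
  apply: qmin; last by move=> x /asboolP/Iq.
  apply: contrapT => nipd; have [s sq' bs] := cycle_split nipd cv.
  move/negP: sq'; apply; apply/asboolP; exists 1; first by rewrite idealr1.
  by rewrite mul1r.
have [|k [g Hg]] := ideal_fg noeR (J := fun a => is_true (a \in q)).
  by split=> [|x y xm ym|a x xm]; [exact: rpred0|exact: rpredD|exact: idealMr].
(* Since [q] is finitely generated, one denominator [s] suffices for all of its
   elements. *)
have [i s t bs|i|s sq Hs] := @common_denom R q 'I_k (fun i s => bnd ((s * g i) *: v)).
- by rewrite -mulrA -scalerA; apply: bndZ.
- have /qI[s sq bs] : g i \in q; last by exists s.
  apply/Hg; exists (fun j => (j == i)%:R).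
  rewrite (bigD1 i) //= eqxx mul1r big1 ?addr0 // => j /negPf->.
  by rewrite mul0r.
exists (s *: v); first by rewrite /cyc -scalemxAl cv scaler0.
move=> a; split=> [/Hg[c ->]|]; rewrite scalerA.
  rewrite mulr_suml scaler_suml; elim/big_rec: _ => [|i x _ bx].
    by exists 0; rewrite mul0mx.
  apply: bndD => //; rewrite -mulrA -scalerA [g i * s]mulrC; exact: bndZ.
by rewrite mulrC => bsa; apply: Iq; exists s.
Qed.

(** The comparison map [H_1 (F T) -> F M] is injective, because the first
    homology of the cone of [F phi] vanishes. *)
Lemma comparison_injective v Y : cyc v ->
  v *m map_mx f (phi 0) = Y *m map_mx f (dif P 0) -> bnd v.
Proof.
move=> cv vY; have [_ comm [k iso]] := Tcompl; have [_ _ exP] := res.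
have cpxT : is_cpx T by move=> i; apply/exmx_mul0/exT.
have cpxP : is_cpx P by move=> i; apply/exmx_mul0/exP.
have := @peskine_szpiro _ _ hp n noeR _ _ (cone_cpx comm cpxT cpxP)
  (cone_exact comm exT exP) (cone_split comm iso).
move=> /(_ 0%N isT (row_mx v (- Y)))[+ _] => /=.
rewrite !map_block_mx !map_mx0 mul_row_block mulmx0 addr0 map_mxN mulmxN cv.
rewrite oppr0 mulNmx vY subrr row_mx0 => /(_ erefl)[w].
rewrite -[w]hsubmxK mul_row_block mulmx0 addr0 => /eq_row_mx[-> _].
by exists (- lsubmx w); rewrite map_mxN mulmxN mulNmx.
Qed.

Lemma minimal_IPD_Ass (q : prime_idealr R) :
  minimal_in (IPD M) q -> strongly_rigid (frob_module (loc_pchar q hp) n) ->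
  Ass (frob_functor hp n M) q.
Proof.
move=> qmin rigid; have [v cv ann] := cycle_annihilator rigid qmin.
have [_ comm _] := Tcompl.
pose u := v *m map_mx f (phi 0).
exists (\sum_j tens_mk (aug (delta_mx 0 j)) (u 0 j : restr f R^o) : base_change f M).
move=> a; rewrite scaler_sumr.
under eq_bigr do rewrite [_ *: _]bc_scaleE.
have aE : \sum_j tens_mk (aug (delta_mx 0 j)) (a * u 0 j : restr f R^o)
  = \sum_j tens_mk (aug (delta_mx 0 j)) ((a *: u) 0 j : restr f R^o).
  by apply: eq_bigr => j _; congr tens_mk; rewrite [RHS]mxE.
rewrite aE (base_change_relations f (a *: u) res) ann /u scalemxAl.
split=> [[w ->]|[Y /comparison_injective]].
  exists (w *m map_mx f (phi 1)).
  by rewrite -!mulmxA -!map_mxM comm.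
by apply; rewrite /cyc -scalemxAl cv scaler0.
Qed.

End Main.

Theorem theorem2p5 (R : comNzRingType) (p : nat) (hp : p \in [pchar R])
    (hR : gorenstein_local R) (n : nat) (hn : (0 < n)%N)
    (M : lmodType R) (hM : fin_gen M) :
  (forall q : prime_idealr R,
     minimal_in (IPD M) q /\ SR hp n q -> Ass (frob_functor hp n M) q) /\
  (locally_strongly_rigid (frob_module hp n) ->
   forall q : prime_idealr R,
     minimal_in (IPD M) q -> Ass (frob_functor hp n M) q).
Proof.
have [noeR _ injR] := hR.
have [P [aug res]] := free_res_exists noeR hM.
have [_ _ exP] := res.
have [T [phi Tcompl]] := completion_exists noeR injR exP.
have [/(coexact_exact injR) exT _ _] := Tcompl.
have main q := @minimal_IPD_Ass R p hp n M P T phi aug noeR res Tcompl exT q.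
split=> [q [qmin sr]|rigid q qmin]; apply: main => //.
exact: strongly_rigid_loc.
Qed.
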